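(* Let $S_1$ and $S_2$ be finite nonempty subsets of $\mathbb{Z}$ and let $U_1$ and $U_2$ be irreducible modules for $\mathfrak{gl}_{S_1}$ and $\mathfrak{gl}_{S_2}$, respectively. Set $S=S_1\cup S_2$. Then $L(S_1,U_1)\simeq L(S_2,U_2)$ as $\mathfrak{gl}_\infty$-modules if and only if $U_1^S\simeq U_2^S$ as $\mathfrak{gl}_S$-modules.
   Context: All vector spaces are over $\mathbb{C}$. $\mathfrak{gl}_\infty$ is the Lie algebra of doubly infinite matrices (indexed by $\mathbb{Z}\times\mathbb{Z}$) with finitely many nonzero entries, with basis the matrix units $E_{m,n}$ ($m,n\in\mathbb{Z}$) and $[E_{m,n},E_{r,s}]=\delta_{n,r}E_{m,s}-\delta_{m,s}E_{r,n}$. For a finite nonempty $S\subset\mathbb{Z}$ put $\mathfrak{gl}_S=\mathrm{span}\{E_{m,n}: m,n\in S\}$, $I_S=\sum_{n\in S}E_{n,n}$, $\mathfrak{gl}_\infty^{(S,+)}=\mathrm{span}\{E_{m,n}: m\in\mathbb{Z},\ n\notin S\}$. For a $\mathfrak{gl}_S$-module $U$, let $\mathfrak{gl}_\infty^{(S,+)}$ act trivially on $U$, and set $M(S,U)=U(\mathfrak{gl}_\infty)\otimes_{U(\mathfrak{gl}_\infty^{(S,+)}+\mathfrak{gl}_S)}U$. Give $\mathfrak{gl}_\infty$ the $\mathbb{Z}$-grading in which $E_{m,n}$ has degree $1$ if $m\in S,n\notin S$, degree $-1$ if $m\notin S,n\in S$, and degree $0$ otherwise; with $U$ in degree $0$,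 $M(S,U)$ is a $\mathbb{Z}$-graded module with degree-$0$ subspace $U$. $L(S,U)$ is the quotient of $M(S,U)$ by the maximal graded submodule whose degree-$0$ subspace is zero. Given a finite $S\subset\mathbb{Z}$, a nonempty $S_1\subset S$ and an irreducible $\mathfrak{gl}_{S_1}$-module $U_1$ (on which $I_{S_1}$ necessarily acts as a scalar $\alpha$), let $N=\mathrm{span}\{E_{p,q}: p,q\in S,\ q\notin S_1\}$ and $B=N+\mathfrak{gl}_{S_1}$; $N$ is an ideal of the subalgebra $B$ of $\mathfrak{gl}_S$. Letting $N$ act trivially on $U_1$, form $\mathrm{ind}_{\mathfrak{gl}_{S_1}}^{\mathfrak{gl}_S}(U_1)=U(\mathfrak{gl}_S)\otimes_{U(B)}U_1$. It is graded by $I_{S_1}$-eigenvalues, with $U_1$ the $\alpha$-eigenspace, and has a unique maximal (proper) submodule; $U_1^S$ denotes its unique irreducible quotient $\mathfrak{gl}_S$-module. *)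

(* Defs.v *)
From HB Require Import structures.
From mathcomp Require Import all_boot all_order all_algebra.
From mathcomp Require Import finmap boolp classical_sets reals.
From mathcomp Require Import complex.
From mathcomp.multinomials Require Import monalg.

Set Implicit Arguments.
Unset Strict Implicit.
Unset Printing Implicit Defensive.

Import GRing.Theory.
Local Open Scope classical_set_scope.
Local Open Scope quotient_scope.
Local Open Scope ring_scope.

Section Span.
Variables (F : fieldType) (V : lmodType F).

Definition is_subspace (K : set V) : Prop :=
  K 0 /\ forall c v w, K v -> K w -> K (c *: v + w).

Inductive lspan (G : set V) : set V :=
| lspan0 : lspan G 0
| lspanS c x y : G x -> lspan G y -> lspan G (c *: x + y).

Lemma lspan_gen (G : set V) x : G x -> lspan G x.
Proof.
by move=> Gx; rewrite -[x]scale1r -[_ *: _]addr0; apply: lspanS Gx (lspan0 G).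
Qed.

Lemma lspan_subspace (G : set V) : is_subspace (lspan G).
Proof.
split=> [|c x y Gx Gy]; first exact: lspan0.
elim: Gx => [|d z t Gz _ IH]; first by rewrite scaler0 add0r.
by rewrite scalerDr scalerA -addrA; apply: lspanS.
Qed.

Lemma lspan_min (G K : set V) : is_subspace K -> G `<=` K -> lspan G `<=` K.
Proof.
by case=> K0 KS GK x; elim=> // c y z Gy _ Kz; apply: KS => //; apply: GK.
Qed.

Definition in_lspan (G : set V) : pred V := fun v => `[< lspan G v >].

Lemma in_lspan_submod_closed (G : set V) : submod_closed (in_lspan G).
Proof.
have [K0 KS] := lspan_subspace G.
split=> [|c x y /asboolP Gx /asboolP Gy]; first exact/asboolP.
by apply/asboolP; apply: KS.
Qed.

HB.instance Definition _ (G : set V) := GRing.isSubmodClosed.Build F V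
  (in_lspan G) (GRing.submod_closed_semi (in_lspan_submod_closed G)).

Definition lspan_closed (G : set V) : GRing.ZmodClosed.type V :=
  GRing.ZmodClosed.clone V (in_lspan G) _.

End Span.

(* freemod F B is the vector space with basis B, that is {malg F[B]}. Its
   operations are those of {malg F[B]}, but locked: otherwise unification
   unfolds finitely supported functions. *)
Definition freemod (F : fieldType) (B : choiceType) := {malg F[B]}.

HB.lock Definition fm_zero (F : fieldType) (B : choiceType) : freemod F B :=
  (0 : {malg F[B]}).
HB.lock Definition fm_opp (F : fieldType) (B : choiceType)
  (x : freemod F B) : freemod F B := (- x : {malg F[B]}).
HB.lock Definition fm_add (F : fieldType) (B : choiceType)
  (x y : freemod F B) : freemod F B := (x + y : {malg F[B]}).
HB.lock Definition fm_scale (F : fieldType) (B : choiceType)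
  (c : F) (x : freemod F B) : freemod F B := (c *: x : {malg F[B]}).
HB.lock Definition fm_basis (F : fieldType) (B : choiceType)
  (b : B) : freemod F B := (<< b >> : {malg F[B]}).

Section FreeModule.
Variables (F : fieldType) (B : choiceType).
Local Notation fm := (freemod F B).

HB.instance Definition _ := Choice.on fm.

Lemma fm_addA : associative (@fm_add F B).
Proof. by move=> x y z; rewrite !fm_add.unlock addrA. Qed.

Lemma fm_addC : commutative (@fm_add F B).
Proof. by move=> x y; rewrite !fm_add.unlock addrC. Qed.

Lemma fm_add0 : left_id (fm_zero F B) (@fm_add F B).
Proof. by move=> x; rewrite fm_add.unlock fm_zero.unlock add0r. Qed.

Lemma fm_addN : left_inverse (fm_zero F B) (@fm_opp F B) (@fm_add F B).
Proof.
by move=> x; rewrite fm_add.unlock fm_zero.unlock fm_opp.unlock addNr.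
Qed.

HB.instance Definition _ :=
  GRing.isZmodule.Build fm fm_addA fm_addC fm_add0 fm_addN.

Lemma fm_addE (x y : fm) : x + y = (x : {malg F[B]}) + (y : {malg F[B]}).
Proof. by rewrite -[LHS]/(fm_add x y) fm_add.unlock. Qed.

Lemma fm_scaleA a b (x : fm) : fm_scale a (fm_scale b x) = fm_scale (a * b) x.
Proof. by rewrite fm_scale.unlock scalerA. Qed.

Lemma fm_scale1 : left_id 1 (@fm_scale F B).
Proof. by move=> x; rewrite fm_scale.unlock scale1r. Qed.

Lemma fm_scaleDr : right_distributive (@fm_scale F B) +%R.
Proof. by move=> c x y; rewrite !fm_addE fm_scale.unlock scalerDr. Qed.

Lemma fm_scaleDl (x : fm) : {morph (@fm_scale F B)^~ x : a b / a + b}.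
Proof. by move=> a b; rewrite fm_addE fm_scale.unlock scalerDl. Qed.

HB.instance Definition _ := GRing.Zmodule_isLmodule.Build F fm
  fm_scaleA fm_scale1 fm_scaleDr fm_scaleDl.

Lemma fm_coefD (x y : fm) b : (x + y : fm)@_b = x@_b + y@_b.
Proof. by rewrite fm_addE mcoeffD. Qed.

Lemma fm_coefZ c (x : fm) b : (c *: x : fm)@_b = c * x@_b.
Proof. by rewrite -[c *: x]/(fm_scale c x) fm_scale.unlock mcoeffZ. Qed.

Lemma fm_coef0 b : (0 : fm)@_b = 0.
Proof. by rewrite -[0 : fm]/(fm_zero F B) fm_zero.unlock mcoeff0. Qed.

Lemma fm_coef_basis b b' : (@fm_basis F B b)@_b' = (b == b')%:R.
Proof. by rewrite fm_basis.unlock mcoeffU. Qed.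

Lemma fmP (x y : fm) : (forall b, x@_b = y@_b) -> x = y.
Proof. by move=> /malgP. Qed.

End FreeModule.
Arguments fm_basis {F B} b.

HB.lock Definition lext (F : fieldType) (B : choiceType) (W : lmodType F)
  (f : B -> W) (x : freemod F B) : W := \sum_(b <- msupp x) x@_b *: f b.

Section LinearExtension.
Variables (F : fieldType) (B : choiceType) (W : lmodType F) (f : B -> W).

Lemma lextE x : lext f x = \sum_(b <- msupp x) x@_b *: f b.
Proof. by rewrite lext.unlock. Qed.

Lemma lextEw (d : {fset B}) x : (msupp x `<=` d)%fset ->
  lext f x = \sum_(b <- d) x@_b *: f b.
Proof.
move=> le; rewrite lextE [LHS](big_fset_incl _ le) => //= b bd /mcoeff_outdom ->.
by rewrite scale0r.
Qed.

Lemma lext_is_linear : linear (lext f).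
Proof.
move=> c x y; pose d := (msupp (c *: x + y) `|` msupp x `|` msupp y)%fset.
rewrite !(@lextEw d); try by apply/fsubsetP => b bd; rewrite !inE bd ?orbT.
rewrite scaler_sumr -big_split /=; apply: eq_bigr => b _.
by rewrite fm_coefD fm_coefZ scalerDl scalerA.
Qed.

HB.instance Definition _ :=
  GRing.isLinear.Build F (freemod F B) W *:%R (lext f) lext_is_linear.

Lemma lextU b : lext f (fm_basis b) = f b.
Proof.
rewrite fm_basis.unlock (lextEw msuppU_le) big_seq_fset1 mcoeffUU.
by rewrite scale1r.
Qed.

End LinearExtension.

Lemma fm_decomp (F : fieldType) (B : choiceType) (x : freemod F B) :
  x = \sum_(b <- msupp x) x@_b *: fm_basis b.
Proof.
apply: fmP => k; pose f (y : freemod F B) := y@_k.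
rewrite -![_@_k]/(f _) (big_morph f (fun a b => fm_coefD a b k) (fm_coef0 _ k)).
rewrite /f [x in LHS]monalgE raddf_sum; apply: eq_bigr => b _ /=.
by rewrite fm_coefZ fm_coef_basis mcoeffU mulr_natr.
Qed.

Lemma fm_ind (F : fieldType) (B : choiceType) (P : freemod F B -> Prop) :
  P 0 -> (forall c b x, P x -> P (c *: fm_basis b + x)) -> forall x, P x.
Proof.
move=> P0 PS x; rewrite [x]fm_decomp.
by elim/big_rec: _ => // b y _; apply: PS.
Qed.

Section QuotientSpace.
Variables (F : fieldType) (V : lmodType F) (G : set V).

(* The quotient vector space of V by the subspace spanned by G. *)
Definition qspace := Quotient.quot (lspan_closed G).

HB.instance Definition _ := GRing.Zmodule.on qspace.

Definition qpi (v : V) : qspace := \pi_(Quotient.quot (lspan_closed G)) v.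
Definition qrepr (m : qspace) : V := repr (m : Quotient.quot (lspan_closed G)).

Lemma qreprK : cancel qrepr qpi.
Proof. by move=> m; rewrite /qpi /qrepr reprK. Qed.

Lemma qpiP v w : qpi v = qpi w <-> lspan G (v - w).
Proof.
split=> [/eqP|] h.
  by move: h; rewrite /qpi -Quotient.idealrBE => /asboolP.
by apply/eqP; rewrite /qpi -Quotient.idealrBE; apply/asboolP.
Qed.

Lemma qpiB : zmod_morphism qpi.
Proof. by move=> v w; rewrite /qpi !piE. Qed.

HB.instance Definition _ := GRing.isZmodMorphism.Build V qspace qpi qpiB.

Definition qscale (c : F) (m : qspace) : qspace := qpi (c *: qrepr m).

Lemma qpiZ c v : qpi (c *: v) = qscale c (qpi v).
Proof.
apply/qpiP; rewrite -scalerBr -[_ *: _]addr0.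
have [G0 GS] := lspan_subspace G; apply: GS => //.
by apply/qpiP; rewrite qreprK.
Qed.

Lemma qscaleA a b m : qscale a (qscale b m) = qscale (a * b) m.
Proof. by rewrite -[m]qreprK -!qpiZ scalerA. Qed.

Lemma qscale1 : left_id 1 qscale.
Proof. by move=> m; rewrite -[m]qreprK -qpiZ scale1r. Qed.

Lemma qscaleDr : right_distributive qscale +%R.
Proof.
move=> c m n; rewrite -[m]qreprK -[n]qreprK -(raddfD qpi) -!qpiZ.
by rewrite scalerDr (raddfD qpi).
Qed.

Lemma qscaleDl m : {morph qscale^~ m : a b / a + b}.
Proof. by move=> a b; rewrite -[m]qreprK -!qpiZ scalerDl (raddfD qpi). Qed.

HB.instance Definition _ := GRing.Zmodule_isLmodule.Build F qspace
  qscaleA qscale1 qscaleDr qscaleDl.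

HB.instance Definition _ := GRing.isScalable.Build F V qspace *:%R qpi qpiZ.

End QuotientSpace.

Section QuotientMap.
Variables (F : fieldType) (V W : lmodType F) (G : set V) (H : set W).
Variable f : V -> W.

Definition qmap (m : qspace G) : qspace H := qpi H (f (qrepr m)).

Hypotheses (flin : linear f) (fGH : forall x, G x -> lspan H (f x)).

Lemma qmapE v : qmap (qpi G v) = qpi H (f v).
Proof.
have fB a b : f (a - b) = f a - f b.
  by rewrite addrC -scaleN1r flin scaleN1r addrC.
have f0 : f 0 = 0 by rewrite -[0 in LHS](subrr 0) fB subrr.
apply/qpiP; rewrite -fB.
have /qpiP : qpi G (qrepr (qpi G v)) = qpi G v by rewrite qreprK.
elim=> [|c x y Gx _ IH]; first by rewrite f0; apply: lspan0.
by rewrite flin; apply: (lspan_subspace H).2 => //; apply: fGH.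
Qed.

Lemma qmap_linear : linear qmap.
Proof.
move=> c m n; rewrite -[m]qreprK -[n]qreprK -linearP !qmapE.
by rewrite flin linearP.
Qed.

End QuotientMap.

(* gl_infty: a matrix with finitely many nonzero entries is a finitely
   supported function on int * int; x@_(m, n) is the entry of x at (m, n). *)
Definition gl (F : fieldType) := freemod F (int * int)%type.
HB.instance Definition _ (F : fieldType) := GRing.Lmodule.on (gl F).

Definition E (F : fieldType) (m n : int) : gl F := fm_basis (m, n).

Section GlInfinity.
Variable F : fieldType.
Local Notation gl := (gl F).
Local Notation E := (E F).

Definition bracketE (p q : int * int) : gl :=
  (p.2 == q.1)%:R *: E p.1 q.2 - (p.1 == q.2)%:R *: E q.1 p.2.

Definition bracket (x y : gl) : gl :=
  lext (fun p => lext (fun q => bracketE p q) y) x.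

Lemma bracket_linear_l y : linear (bracket^~ y).
Proof. exact: lext_is_linear. Qed.

Lemma bracket_linear_r x : linear (bracket x).
Proof.
move=> c y z; rewrite /bracket !lextE scaler_sumr -big_split /=.
by apply: eq_bigr => p _; rewrite linearP scalerDr !scalerA mulrC.
Qed.

Lemma bracket_E m n r s : bracket (E m n) (E r s) =
  (n == r)%:R *: E m s - (m == s)%:R *: E r n.
Proof. by rewrite /bracket !lextU. Qed.

(* The span of the matrix units E m n with P m n. *)
Definition mspan (P : int -> int -> Prop) : set gl :=
  lspan [set x | exists m n, P m n /\ x = E m n].

Lemma mspan_E (P : int -> int -> Prop) m n : P m n -> mspan P (E m n).
Proof. by move=> Pmn; apply: lspan_gen; exists m, n. Qed.

Definition is_subalgebra (h : set gl) : Prop :=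
  is_subspace h /\ forall x y, h x -> h y -> h (bracket x y).

Lemma bracket0l y : bracket 0 y = 0.
Proof. by have := bracket_linear_l y (-1) 0 0; rewrite !scaleN1r oppr0 addr0 addNr. Qed.

Lemma bracket0r x : bracket x 0 = 0.
Proof. by have := bracket_linear_r x (-1) 0 0; rewrite !scaleN1r oppr0 addr0 addNr. Qed.

Lemma mspan_subalgebra (P : int -> int -> Prop) :
  (forall m n s, P m n -> P n s -> P m s) -> is_subalgebra (mspan P).
Proof.
move=> Ptr; have [G0 GS] := lspan_subspace
  [set x | exists m n, P m n /\ x = E m n].
split=> [|x y Gx]; first exact: lspan_subspace.
elim: Gx y => [|c _ x' [m [n [mn ->]]] _ IHx] y Gy; first by rewrite bracket0l.
rewrite bracket_linear_l; apply: (GS); last exact: IHx.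
elim: Gy => [|d _ y' [r [s [rs ->]]] _ IHy]; first by rewrite bracket0r.
rewrite bracket_linear_r; apply: (GS); last exact: IHy.
rewrite bracket_E.
have GB a b : mspan P a -> mspan P b -> mspan P (a - b).
  by move=> Ga Gb; rewrite addrC -scaleN1r; apply: GS.
apply: GB; case: eqP => [e|_]; rewrite ?scale1r ?scale0r //; apply: mspan_E.
  by apply: (Ptr _ n) => //; rewrite e.
by apply: (Ptr _ s) => //; rewrite -e.
Qed.

Definition set_add (A B : set gl) : set gl :=
  [set z | exists x y, [/\ A x, B y & z = x + y]].

Lemma mspan_add (P Q : int -> int -> Prop) :
  set_add (mspan P) (mspan Q) = mspan (fun m n => P m n \/ Q m n).
Proof.
have [G0 GS] := lspan_subspace
  [set x | exists m n, (P m n \/ Q m n) /\ x = E m n].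
apply/seteqP; split=> x.
  case=> y [z [Py Qz ->]]; rewrite -[y]scale1r; apply: GS.
    move: Py; apply: lspan_min; first exact: lspan_subspace.
    by move=> _ [m [n [mn ->]]]; apply: mspan_E; left.
  move: Qz; apply: lspan_min; first exact: lspan_subspace.
  by move=> _ [m [n [mn ->]]]; apply: mspan_E; right.
elim=> [|c _ y [m [n [mn ->]]] _ [p [q [Pp Qq ->]]]].
  by exists 0, 0; rewrite addr0; split=> //; apply: lspan0.
case: mn => mn.
  exists (c *: E m n + p), q; rewrite addrA; split=> //.
  by apply: lspanS Pp; exists m, n.
exists p, (c *: E m n + q); rewrite addrCA; split=> //.
by apply: lspanS Qq; exists m, n.
Qed.

Record lieSubalg := LieSubalg {
  lsub :> set gl;
  lsub_subalgebra : is_subalgebra lsub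
}.

Lemma setT_subalgebra : is_subalgebra [set: gl].
Proof. by []. Qed.

Definition gl_full : lieSubalg := LieSubalg setT_subalgebra.

Lemma gl_sub_subalgebra (S : {fset int}) :
  is_subalgebra (mspan (fun m n => m \in S /\ n \in S)).
Proof. by apply: mspan_subalgebra => m n s [mS _] [_ sS]. Qed.

(* gl_S *)
Definition gl_sub (S : {fset int}) : lieSubalg :=
  LieSubalg (gl_sub_subalgebra S).

(* gl_infty^(S,+) *)
Definition gl_plus (S : {fset int}) : set gl := mspan (fun m n => n \notin S).

(* The ideal N of B *)
Definition gl_nil (S S1 : {fset int}) : set gl :=
  mspan (fun p q => [/\ p \in S, q \in S & q \notin S1]).

Lemma gl_par_subalgebra (S : {fset int}) :
  is_subalgebra (set_add (gl_plus S) (gl_sub S)).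
Proof.
rewrite mspan_add; apply: mspan_subalgebra => m n s.
case=> [nS|[mS nS]] [sS|[nS' sS]]; try by left.
  by rewrite nS' in nS.
by right.
Qed.

(* gl_infty^(S,+) + gl_S *)
Definition gl_par (S : {fset int}) : lieSubalg :=
  LieSubalg (gl_par_subalgebra S).

Lemma gl_par_in_subalgebra (S S1 : {fset int}) : (S1 `<=` S)%fset ->
  is_subalgebra (set_add (gl_nil S S1) (gl_sub S1)).
Proof.
move=> /fsubsetP sub; rewrite mspan_add; apply: mspan_subalgebra => m n s.
case=> [[mS nS nS1]|[mS1 nS1]] [[nS' sS sS1]|[nS1' sS1]].
- by left.
- by rewrite nS1' in nS1.
- by left; split=> //; apply: sub.
- by right.
Qed.

(* B = N + gl_S1 *)
Definition gl_par_in (S S1 : {fset int}) (sS1 : (S1 `<=` S)%fset) : lieSubalg :=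
  LieSubalg (gl_par_in_subalgebra sS1).

Lemma gl_par_in_sub (S S1 : {fset int}) (sS1 : (S1 `<=` S)%fset) :
  gl_par_in sS1 `<=` gl_par S1.
Proof.
move=> _ [x [y [Nx Sy ->]]]; exists x, y; split=> //.
move: Nx; apply: lspan_min; first exact: lspan_subspace.
by move=> _ [m [n [[_ _ nS1] ->]]]; apply: mspan_E.
Qed.

(* The projection of gl_par S onto gl_sub S along gl_plus S. *)
Definition trunc (S : {fset int}) : gl -> gl :=
  lext (fun p => if (p.1 \in S) && (p.2 \in S) then E p.1 p.2 else 0).

Lemma trunc_linear S : linear (trunc S).
Proof. exact: lext_is_linear. Qed.

Lemma trunc_E S m n :
  trunc S (E m n) = if (m \in S) && (n \in S) then E m n else 0.
Proof. by rewrite /trunc lextU. Qed.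

Lemma trunc_gl_sub S x : lsub (gl_sub S) (trunc S x).
Proof.
have [S0 SS] := lspan_subspace
  [set x | exists m n, (m \in S /\ n \in S) /\ x = E m n].
rewrite /trunc lextE; elim/big_ind: _ => [|y z Sy Sz|p _].
- exact: lspan0.
- by rewrite -[y]scale1r; apply: SS.
rewrite -[_ *: _]addr0; apply: SS; last exact: lspan0.
case: ifP => [/andP[mS nS]|_]; first exact: mspan_E.
exact: lspan0.
Qed.

Lemma trunc_bracket S x y : lsub (gl_par S) x -> lsub (gl_par S) y ->
  trunc S (bracket x y) = bracket (trunc S x) (trunc S y).
Proof.
have trP := trunc_linear S.
have tr0 : trunc S 0 = 0.
  by have := trP (-1) 0 0; rewrite !scaleN1r oppr0 addr0 addNr.
have trZ (a : F) u : trunc S (a *: u) = a *: trunc S u.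
  by have := trP a u 0; rewrite tr0 !addr0.
have trB (a b : F) u v :
    trunc S (a *: u - b *: v) = a *: trunc S u - b *: trunc S v.
  by rewrite trP -scaleNr trZ scaleNr.
rewrite /= mspan_add => Gx Gy.
elim: Gx => [|c _ x' [m [n [mn ->]]] _ IHx]; first by rewrite tr0 !bracket0l.
suff trE : trunc S (bracket (E m n) y) = bracket (trunc S (E m n)) (trunc S y).
  by rewrite bracket_linear_l !trP bracket_linear_l IHx trE.
elim: Gy => [|d _ y' [r [s [rs ->]]] _ IHy]; first by rewrite tr0 !bracket0r.
suff trE : trunc S (bracket (E m n) (E r s)) =
    bracket (trunc S (E m n)) (trunc S (E r s)).
  by rewrite bracket_linear_r !trP bracket_linear_r IHy trE.
rewrite bracket_E trB !trunc_E.
have {}mn : (n \in S) ==> (m \in S).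
  by case: mn => [/negbTE->|[-> _]]; rewrite ?implybT.
have {}rs : (s \in S) ==> (r \in S).
  by case: rs => [/negbTE->|[-> _]]; rewrite ?implybT.
case: (boolP (n \in S)) mn => [nS /= mS|nS _].
  rewrite mS /= andbT; case: (boolP (s \in S)) rs => [sS /= rS|sS _].
    by rewrite rS /= bracket_E.
  rewrite andbF bracket0r scaler0 sub0r; case: eqP => [e|_].
    by rewrite -e mS in sS.
  by rewrite scale0r oppr0.
rewrite !andbF bracket0l scaler0 subr0.
case: (boolP (s \in S)) rs => [sS /= rS|_ _]; last by rewrite andbF scaler0.
case: eqP => [e|_]; last by rewrite scale0r.
by rewrite e rS in nS.
Qed.

End GlInfinity.

(* A module over a subalgebra h of gl_infty; as for morphisms of finite
   groups, the action is a total function and is only relevant on h. *)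
Record lieModule (F : fieldType) (h : lieSubalg F) := LieModule {
  lcarrier :> lmodType F;
  lact : gl F -> lcarrier -> lcarrier;
  lact_linear_l : forall c x y v, lsub h x -> lsub h y ->
    lact (c *: x + y) v = c *: lact x v + lact y v;
  lact_linear_r : forall x, lsub h x -> linear (lact x);
  lact_bracket : forall x y v, lsub h x -> lsub h y ->
    lact (bracket x y) v = lact x (lact y v) - lact y (lact x v)
}.

Section Modules.
Variables (F : fieldType) (h : lieSubalg F).
Implicit Types V W : lieModule h.

Definition is_submodule V (K : set V) : Prop :=
  is_subspace K /\ forall x v, lsub h x -> K v -> K (lact x v).

Definition irreducible V : Prop :=
  (exists v : V, v <> 0) /\
  forall K : set V, is_submodule K -> K = [set 0] \/ K = setT.

Definition lie_iso V W : Prop :=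
  exists f : {linear V -> W}, bijective f /\
    forall x v, lsub h x -> f (lact x v) = lact x (f v).

Definition sum_of V (P : set (set V)) : set V := lspan (\bigcup_(K in P) K).

Lemma sum_of_submodule V (P : set (set V)) :
  (forall K, P K -> is_submodule K) -> is_submodule (sum_of P).
Proof.
move=> PK; split=> [|x v hx]; first exact: lspan_subspace.
have lin := @lact_linear_r _ _ V x hx.
elim=> [|c w z [K Kin Kw] _ IH].
  have := lin (-1) 0 0; rewrite !scaleN1r oppr0 addr0 addNr => ->.
  exact: lspan0.
rewrite lin; apply: lspanS IH; exists K => //.
by have [_ Kx] := PK _ Kin; apply: Kx.
Qed.

Section QuotientModule.
Variables (V : lieModule h) (K : set V) (Ksub : is_submodule K).

Definition quo_act (x : gl F) : qspace K -> qspace K := qmap K (lact x).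

Lemma quo_actE x v : lsub h x -> quo_act x (qpi K v) = qpi K (lact x v).
Proof.
move=> hx; apply: qmapE => [|w Kw]; first exact: lact_linear_r.
by apply: lspan_gen; apply: Ksub.2.
Qed.

Lemma quo_act_linear_l c x y m : lsub h x -> lsub h y ->
  quo_act (c *: x + y) m = c *: quo_act x m + quo_act y m.
Proof.
move=> hx hy; have [[_ hS] _] := lsub_subalgebra h.
rewrite -[m]qreprK !quo_actE //; last exact: hS.
by rewrite lact_linear_l // linearP.
Qed.

Lemma quo_act_linear_r x : lsub h x -> linear (quo_act x).
Proof.
move=> hx c m n; rewrite -[m]qreprK -[n]qreprK -linearP !quo_actE //.
by rewrite lact_linear_r // linearP.
Qed.

Lemma quo_act_bracket x y m : lsub h x -> lsub h y ->
  quo_act (bracket x y) m = quo_act x (quo_act y m) - quo_act y (quo_act x m).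
Proof.
move=> hx hy; have [_ hB] := lsub_subalgebra h.
rewrite -[m]qreprK !quo_actE //; last exact: hB.
by rewrite lact_bracket // linearB.
Qed.

Definition quotient_module : lieModule h :=
  LieModule quo_act_linear_l quo_act_linear_r quo_act_bracket.

End QuotientModule.

End Modules.

Section QuotientAlgebra.
Variables (F : fieldType) (A : algType F) (R : set A).

Definition ideal_gen : set A :=
  [set z | exists a r b, R r /\ z = a * r * b].

(* The quotient of A by the two-sided ideal generated by R. *)
Definition qalg := qspace ideal_gen.
HB.instance Definition _ := GRing.Lmodule.on qalg.

Definition qalg_pi : A -> qalg := qpi ideal_gen.
Definition qalg_repr : qalg -> A := @qrepr _ _ ideal_gen.
HB.instance Definition _ := GRing.Linear.on qalg_pi.

Lemma qalg_reprK : cancel qalg_repr qalg_pi.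
Proof. exact: qreprK. Qed.

Lemma qalg_piP a b : qalg_pi a = qalg_pi b <-> lspan ideal_gen (a - b).
Proof. exact: qpiP. Qed.

Lemma ideal_mul a b z : lspan ideal_gen z -> lspan ideal_gen (a * z * b).
Proof.
elim=> [|c x y [d [r [e [rr ->]]]] _ IH].
  by rewrite mulr0 mul0r; apply: lspan0.
rewrite mulrDr mulrDl -scalerAr -scalerAl; apply: lspanS IH.
by exists (a * d), r, (e * b); rewrite !mulrA.
Qed.

Definition qalg_mul (u v : qalg) : qalg :=
  qalg_pi (qalg_repr u * qalg_repr v).

Lemma qalg_piM a b : qalg_pi (a * b) = qalg_mul (qalg_pi a) (qalg_pi b).
Proof.
apply/qalg_piP; set a' := qalg_repr _; set b' := qalg_repr _.
have /qalg_piP Ga : qalg_pi a = qalg_pi a' by rewrite qalg_reprK.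
have /qalg_piP Gb : qalg_pi b = qalg_pi b' by rewrite qalg_reprK.
have -> : a * b - a' * b' = 1 *: (1 * (a - a') * b) + a' * (b - b') * 1.
  by rewrite scale1r mul1r mulr1 mulrBl mulrBr addrA subrK.
by apply: (lspan_subspace _).2; apply: ideal_mul.
Qed.

Lemma qalg_mulA : associative qalg_mul.
Proof.
move=> u v w; rewrite -[u]qalg_reprK -[v]qalg_reprK -[w]qalg_reprK.
by rewrite -!qalg_piM mulrA.
Qed.

Lemma qalg_mul1r : left_id (qalg_pi 1) qalg_mul.
Proof. by move=> u; rewrite -[u]qalg_reprK -qalg_piM mul1r. Qed.

Lemma qalg_mulr1 : right_id (qalg_pi 1) qalg_mul.
Proof. by move=> u; rewrite -[u]qalg_reprK -qalg_piM mulr1. Qed.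

Lemma qalg_mulDl : left_distributive qalg_mul +%R.
Proof.
move=> u v w; rewrite -[u]qalg_reprK -[v]qalg_reprK -[w]qalg_reprK.
by rewrite -(raddfD qalg_pi) -!qalg_piM mulrDl (raddfD qalg_pi).
Qed.

Lemma qalg_mulDr : right_distributive qalg_mul +%R.
Proof.
move=> u v w; rewrite -[u]qalg_reprK -[v]qalg_reprK -[w]qalg_reprK.
by rewrite -(raddfD qalg_pi) -!qalg_piM mulrDr (raddfD qalg_pi).
Qed.

HB.instance Definition _ := GRing.Zmodule_isPzRing.Build qalg
  qalg_mulA qalg_mul1r qalg_mulr1 qalg_mulDl qalg_mulDr.

Lemma qalg_piMr a b : qalg_pi (a * b) = qalg_pi a * qalg_pi b.
Proof. exact: qalg_piM. Qed.

Lemma qalg_scaleAl c (u v : qalg) : c *: (u * v) = (c *: u) * v.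
Proof.
rewrite -[u]qalg_reprK -[v]qalg_reprK -[c *: qalg_pi _]linearZ.
by rewrite -!qalg_piMr -[LHS]linearZ -scalerAl.
Qed.

Lemma qalg_scaleAr c (u v : qalg) : c *: (u * v) = u * (c *: v).
Proof.
rewrite -[u]qalg_reprK -[v]qalg_reprK -[c *: qalg_pi _]linearZ.
by rewrite -!qalg_piMr -[LHS]linearZ -scalerAr.
Qed.

End QuotientAlgebra.

Section FreeAlgebra.
Variables (F : fieldType) (T : choiceType).

(* The free associative algebra on T: its basis is the words in T. *)
Definition free_alg := {malg F[{fmonom T}]}.
HB.instance Definition _ := GRing.Lalgebra.on free_alg.

Lemma free_alg_scaleAr c (a b : free_alg) : c *: (a * b) = a * (c *: b).
Proof.
have comm (x : free_alg) : c%:MP * x = x * c%:MP.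
  rewrite !malgM_def fgmulUg fgmulgU; apply: eq_bigr => k _.
  by rewrite mulrC mul1m mulm1.
by rewrite -!mul_malgC !mulrA comm.
Qed.

HB.instance Definition _ :=
  GRing.Lalgebra_isAlgebra.Build F free_alg free_alg_scaleAr.

Definition free_gen (x : T) : free_alg := << fmu x >>.

End FreeAlgebra.

Section Enveloping.
Variables (F : fieldType) (h : lieSubalg F).

Local Notation gen := (@free_gen F (gl F)).

(* U(h) is the free algebra on gl F modulo the two-sided ideal generated by
   these relators; the last kills the generators which are not in h, so that
   only those in h remain. *)
Inductive env_relator : set (free_alg F (gl F)) :=
| env_linear c x y : lsub h x -> lsub h y ->
    env_relator (gen (c *: x + y) - (c *: gen x + gen y))
| env_bracket x y : lsub h x -> lsub h y ->
    env_relator (gen (bracket x y) - (gen x * gen y - gen y * gen x))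
| env_outside x : ~ lsub h x -> env_relator (gen x).

Definition env := qalg env_relator.
HB.instance Definition _ := GRing.Lmodule.on env.
HB.instance Definition _ := GRing.PzRing.on env.

Definition iota (x : gl F) : env := qalg_pi env_relator (gen x).

Lemma env_relatorP a b : env_relator (a - b) ->
  qalg_pi env_relator a = qalg_pi env_relator b.
Proof.
move=> rab; apply/qalg_piP/lspan_gen; exists 1, (a - b), 1.
by rewrite mul1r mulr1.
Qed.

Lemma iota_linear c x y : lsub h x -> lsub h y ->
  iota (c *: x + y) = c *: iota x + iota y.
Proof.
by move=> hx hy; rewrite /iota -linearP; apply/env_relatorP/env_linear.
Qed.

Lemma iota_bracket x y : lsub h x -> lsub h y ->
  iota (bracket x y) = iota x * iota y - iota y * iota x.
Proof.
move=> hx hy; rewrite /iota -[_ * _ in RHS]qalg_piMr.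
rewrite -[X in _ = _ - X]qalg_piMr -linearB.
exact/env_relatorP/env_bracket.
Qed.

Lemma iota_outside x : ~ lsub h x -> iota x = 0.
Proof.
move=> hx; rewrite -[0](linear0 (qalg_pi env_relator)).
by apply/env_relatorP; rewrite subr0; apply: env_outside.
Qed.

End Enveloping.
Arguments iota {F h} x.

Section Induction.
Variables (F : fieldType) (h p : lieSubalg F) (U : lieModule p).

Local Notation free := (freemod F (env h * U)%type).
Local Notation gen a u := (fm_basis (a, u) : free).

(* The tensor product of U(h) and U over U(p), for p a subalgebra of h, as a
   quotient of the vector space with basis U(h) * U. It suffices to impose the
   balancing relation a b (x) u = a (x) b u for b in p, as p generates U(p). *)
Inductive tens_relator : set free :=
| tens_linear_l c a b u :
    tens_relator (gen (c *: a + b) u - (c *: gen a u + gen b u))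
| tens_linear_r c a u v :
    tens_relator (gen a (c *: u + v) - (c *: gen a u + gen a v))
| tens_balanced a x u : lsub p x ->
    tens_relator (gen (a * iota x) u - gen a (lact x u)).

Definition tens := qspace tens_relator.
HB.instance Definition _ := GRing.Lmodule.on tens.

Definition pure (a : env h) (u : U) : tens := qpi tens_relator (gen a u).

Lemma pure_linear_l c a b u : pure (c *: a + b) u = c *: pure a u + pure b u.
Proof. by rewrite /pure -linearP; apply/qpiP/lspan_gen/tens_linear_l. Qed.

Lemma pure_linear_r c a u v : pure a (c *: u + v) = c *: pure a u + pure a v.
Proof. by rewrite /pure -linearP; apply/qpiP/lspan_gen/tens_linear_r. Qed.

Lemma pure_balanced a x u : lsub p x -> pure (a * iota x) u = pure a (lact x u).
Proof. by move=> px; apply/qpiP/lspan_gen/tens_balanced. Qed.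

Lemma tens_ind (P : tens -> Prop) : P 0 ->
  (forall c a u m, P m -> P (c *: pure a u + m)) -> forall m, P m.
Proof.
move=> P0 PS m; rewrite -[m]qreprK.
elim/fm_ind: (qrepr m) => [|c [a u] x IH]; first by rewrite linear0.
by rewrite linearP; apply: (PS c a u _ IH).
Qed.

(* x acts by x (a (x) u) = (x a) (x) u. *)
Definition ind_act (x : gl F) : tens -> tens :=
  qmap tens_relator (lext (fun au => gen (iota x * au.1) au.2)).

Lemma ind_act_well x r : tens_relator r ->
  lspan tens_relator (lext (fun au => gen (iota x * au.1) au.2) r).
Proof.
case=> [c a b u|c a u v|a y u py]; rewrite linearB /= ?lext_is_linear !lextU /=.
- by rewrite mulrDr -qalg_scaleAr; apply: lspan_gen; exact: tens_linear_l.
- by apply: lspan_gen; exact: tens_linear_r.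
- by rewrite mulrA; apply: lspan_gen; exact: tens_balanced.
Qed.

Lemma ind_act_linear_r x : linear (ind_act x).
Proof. by apply: qmap_linear; [exact: lext_is_linear | exact: ind_act_well]. Qed.

Lemma ind_act0 x : ind_act x 0 = 0.
Proof.
by have := ind_act_linear_r x (-1) 0 0; rewrite !scaleN1r oppr0 addr0 addNr.
Qed.

Lemma ind_actE x a u : ind_act x (pure a u) = pure (iota x * a) u.
Proof.
rewrite /ind_act /pure qmapE ?lextU //; first exact: lext_is_linear.
exact: ind_act_well.
Qed.

Lemma ind_act_linear_l c x y m : lsub h x -> lsub h y ->
  ind_act (c *: x + y) m = c *: ind_act x m + ind_act y m.
Proof.
move=> hx hy; elim/tens_ind: m => [|d a u m IH].
  by rewrite !ind_act0 scaler0 addr0.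
rewrite !ind_act_linear_r !ind_actE IH iota_linear // mulrDl -qalg_scaleAl.
rewrite pure_linear_l !scalerDr !scalerA [c * d]mulrC.
by rewrite !addrA; congr (_ + _); rewrite -!addrA; congr (_ + _); rewrite addrC.
Qed.

Lemma ind_act_bracket x y m : lsub h x -> lsub h y ->
  ind_act (bracket x y) m = ind_act x (ind_act y m) - ind_act y (ind_act x m).
Proof.
move=> hx hy; elim/tens_ind: m => [|d a u m IH]; first by rewrite !ind_act0 subr0.
rewrite !ind_act_linear_r !ind_actE IH iota_bracket // mulrBl.
have -> : iota x * iota y * a - iota y * iota x * a =
    (-1) *: (iota y * iota x * a) + iota x * iota y * a.
  by rewrite scaleN1r addrC.
rewrite pure_linear_l scaleN1r [- _ + pure _ _]addrC scalerBr !mulrA opprD.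
by rewrite addrACA.
Qed.

Definition induced : lieModule h :=
  LieModule ind_act_linear_l (fun x _ => ind_act_linear_r x) ind_act_bracket.

End Induction.

Section Inflation.
Variables (F : fieldType) (S : {fset int}) (b : lieSubalg F).
Hypothesis bS : b `<=` gl_par F S.
Variable U : lieModule (gl_sub F S).

Definition infl_act (x : gl F) : U -> U := lact (trunc S x).

Lemma infl_act_linear_l c x y u : lsub b x -> lsub b y ->
  infl_act (c *: x + y) u = c *: infl_act x u + infl_act y u.
Proof.
move=> bx by_; rewrite /infl_act trunc_linear.
by apply: lact_linear_l; apply: trunc_gl_sub.
Qed.

Lemma infl_act_linear_r x : lsub b x -> linear (infl_act x).
Proof. by move=> bx; apply: lact_linear_r; apply: trunc_gl_sub. Qed.

Lemma infl_act_bracket x y u : lsub b x -> lsub b y ->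
  infl_act (bracket x y) u =
  infl_act x (infl_act y u) - infl_act y (infl_act x u).
Proof.
move=> bx by_; rewrite /infl_act trunc_bracket; try exact: bS.
by apply: lact_bracket; apply: trunc_gl_sub.
Qed.

(* U with the part of b in gl_plus S acting trivially. *)
Definition inflation : lieModule b :=
  LieModule infl_act_linear_l infl_act_linear_r infl_act_bracket.

End Inflation.

Section LModule.
Variables (F : fieldType) (S : {fset int}) (U : lieModule (gl_sub F S)).

(* U as a module over gl_infty^(S,+) + gl_S *)
Definition M_base : lieModule (gl_par F S) := inflation (@subset_refl _ _) U.

(* M(S, U) *)
Definition M_mod : lieModule (gl_full F) := induced (gl_full F) M_base.

(* The degree of E e.1 e.2. *)
Definition deg (e : int * int) : int :=
  if (e.1 \in S) && (e.2 \notin S) then 1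
  else if (e.1 \notin S) && (e.2 \in S) then -1 else 0.

(* The degree k subspace of M(S, U), with U in degree 0. *)
Definition M_deg (k : int) : set M_mod :=
  lspan [set m : M_mod | exists (w : seq (int * int)) (u : M_base),
    \sum_(e <- w) deg e = k /\ m = pure (\prod_(e <- w) iota (E F e.1 e.2)) u].

(* K is spanned by its homogeneous elements. *)
Definition is_graded (K : set M_mod) : Prop :=
  K `<=` lspan [set m | K m /\ exists k, M_deg k m].

Definition M_small : set (set M_mod) :=
  [set K | [/\ is_submodule K, is_graded K & K `&` M_deg 0 `<=` [set 0]]].

Lemma M_small_sub K : M_small K -> is_submodule K.
Proof. by case. Qed.

(* L(S, U): the maximal graded submodule of M(S, U) whose degree 0 subspace is
   zero is the sum of all the graded submodules with this property. *)
Definition L_mod : lieModule (gl_full F) :=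
  quotient_module (sum_of_submodule M_small_sub).

End LModule.

Section UpModule.
Variables (F : fieldType) (S S1 : {fset int}) (sS1 : (S1 `<=` S)%fset).
Variable U1 : lieModule (gl_sub F S1).

(* ind_{gl_S1}^{gl_S}(U1) *)
Definition ind_mod : lieModule (gl_sub F S) :=
  induced (gl_sub F S) (inflation (@gl_par_in_sub F S S1 sS1) U1).

Definition ind_proper : set (set ind_mod) :=
  [set K | is_submodule K /\ K <> setT].

Lemma ind_proper_sub K : ind_proper K -> is_submodule K.
Proof. by case. Qed.

(* U1^S: the unique maximal submodule of ind_mod, when U1 is irreducible, is
   the largest proper one, that is the sum of all the proper submodules. *)
Definition up_mod : lieModule (gl_sub F S) :=
  quotient_module (sum_of_submodule ind_proper_sub).

End UpModule.

(* Main.v *)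
(* L(S, U) and U^S are irreducible highest weight modules. Such a module is
   determined by its top: given two of them with the same top U, the submodule
   of their product generated by the diagonal copy of U meets neither factor,
   by comparing eigenvalues of I_S, and so is the graph of an isomorphism.
   Inside an irreducible gl_infty-module with top U1, the gl_S-submodule
   generated by U1 is the top eigenspace of I_S, hence irreducible, hence a copy
   of U1^S; thus L(S1, U1) = L(S, U1^S), and L(S, V) determines V as the top
   eigenspace of I_S.

   I_S acts by a scalar by Dixmier's countable dimension argument. Instead of
   the Poincare-Birkhoff-Witt theorem, the non-vanishing of the induced modules
   is obtained from an explicit module with top U, made of U-valued formal power
   series on a cell of the Grassmannian. *)
From HB Require Import structures.
Require Import Defs.
From mathcomp Require Import all_boot all_order all_algebra.
From mathcomp Require Import finmap multiset boolp classical_sets functions.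
From mathcomp Require Import reals complex.
From mathcomp.multinomials Require Import monalg.

Set Implicit Arguments.
Unset Strict Implicit.
Unset Printing Implicit Defensive.

Import Order.TTheory GRing.Theory Num.Theory.
Local Open Scope classical_set_scope.
Local Open Scope ring_scope.

(** * Highest weight modules *)

(** The scalar by which [I_S] acts on the top turns the grading into an eigenspace decomposition: a
    vector obtained from the top by [k] lowering units has eigenvalue [a - k], and these values are
    distinct in characteristic 0. Hence every submodule of a module generated by its top splits into
    its layers, without any assumption of gradedness, and the graded submodules of M(S, U) with zero
    degree 0 part turn out to be exactly the proper ones. This lets L(S, U) and U^S be treated by
    the same lemmas. The modules [U] may be infinite-dimensional, so the scalar cannot be found as
    an eigenvalue of a finite matrix; countable dimension over an uncountable algebraically closed
    field takes its place. The other obstacle is that a tensor product given by relators could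
    collapse. All that is needed of it is that [U] embeds, and any single module in which [U] sits
    as a top certifies this. *)

Lemma linear_sub (F : fieldType) (V W : lmodType F) (f : V -> W) x y :
  linear f -> f (x - y) = f x - f y.
Proof. by move=> flin; rewrite addrC -scaleN1r flin scaleN1r addrC. Qed.

Lemma linear_at0 (F : fieldType) (V W : lmodType F) (f : V -> W) :
  linear f -> f 0 = 0.
Proof. by move=> flin; rewrite -[0 in LHS](subrr 0) linear_sub // subrr. Qed.

Lemma linearZ_at (F : fieldType) (V W : lmodType F) (f : V -> W) :
  linear f -> forall c x, f (c *: x) = c *: f x.
Proof.
by move=> flin c x; rewrite -[_ *: x]addr0 flin (linear_at0 flin) addr0.
Qed.

Lemma linearD_at (F : fieldType) (V W : lmodType F) (f : V -> W) :
  linear f -> forall x y, f (x + y) = f x + f y.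
Proof. by move=> flin x y; rewrite -[x in LHS]scale1r flin scale1r. Qed.

Lemma linear_sum_at (F : fieldType) (V W : lmodType F) (f : V -> W) :
  linear f -> forall (I : Type) (r : seq I) (Q : pred I) (g : I -> V),
  f (\sum_(i <- r | Q i) g i) = \sum_(i <- r | Q i) f (g i).
Proof.
move=> flin I r Q g.
exact: (big_morph f (linearD_at flin) (linear_at0 flin)).
Qed.

Section Subspaces.
Variables (F : fieldType) (V : lmodType F) (K : set V).
Hypothesis Ks : is_subspace K.

Lemma subspace0 : K 0. Proof. by case: Ks. Qed.

Lemma subspaceZ c v : K v -> K (c *: v).
Proof. by case: Ks => K0 KS Kv; rewrite -[_ *: _]addr0; apply: KS. Qed.

Lemma subspaceD v w : K v -> K w -> K (v + w).
Proof. by case: Ks => _ KS Kv Kw; rewrite -[v]scale1r; apply: KS. Qed.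

Lemma subspaceB v w : K v -> K w -> K (v - w).
Proof.
by move=> Kv Kw; rewrite -scaleN1r; apply: subspaceD => //; apply: subspaceZ.
Qed.

Lemma subspace_sum (I : Type) (r : seq I) (Q : pred I) (f : I -> V) :
  (forall i, Q i -> K (f i)) -> K (\sum_(i <- r | Q i) f i).
Proof.
by move=> Kf; elim/big_ind: _ => //; [exact: subspace0 | exact: subspaceD].
Qed.

(* [T - la n] kills the last component and rescales the others. *)
Lemma eigen_components (T : V -> V) (la : nat -> F) n (vs : nat -> V) :
  linear T -> (forall v, K v -> K (T v)) -> injective la ->
  (forall k, T (vs k) = la k *: vs k) ->
  K (\sum_(k < n) vs k) -> forall k, (k < n)%N -> K (vs k).
Proof.
move=> Tlin KT lainj.
elim: n vs => [//|n IH] vs Tvs Ksum k kn.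
have Klow j : (j < n)%N -> K (vs j).
  move=> jn; pose ws i := (la i - la n) *: vs i.
  have lajn : la j - la n != 0.
    by rewrite subr_eq0; apply/eqP => /lainj jE; rewrite jE ltnn in jn.
  have -> : vs j = (la j - la n)^-1 *: ws j by rewrite scalerA mulVf // scale1r.
  apply: subspaceZ; apply: (IH ws) => // [i|].
    by rewrite /ws (linearZ_at Tlin) Tvs !scalerA mulrC.
  have -> : \sum_(i < n) ws i =
      T (\sum_(i < n.+1) vs i) - la n *: \sum_(i < n.+1) vs i.
    rewrite (linear_sum_at Tlin) scaler_sumr !big_ord_recr /= Tvs opprD addrACA subrr addr0.
    by rewrite -sumrB; apply: eq_bigr => i _; rewrite Tvs -scalerBl.
  by apply: subspaceB; [apply: KT | apply: subspaceZ].
case: (ltnP k n) => [/Klow //|nk].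
have {kn nk} -> : k = n by apply/eqP; rewrite eqn_leq -ltnS kn.
have -> : vs n = \sum_(i < n.+1) vs i - \sum_(i < n) vs i.
  by rewrite big_ord_recr /= addrAC subrr add0r.
by apply: subspaceB => //; apply: subspace_sum => i _; apply: Klow.
Qed.

End Subspaces.

Definition family_sum (F : fieldType) (V : lmodType F) (L : nat -> set V) :
    set V :=
  [set v | exists n (vs : nat -> V), (forall k, L k (vs k)) /\
                                     v = \sum_(k < n) vs k].

Lemma family_sum_subspace (F : fieldType) (V : lmodType F) (L : nat -> set V) :
  (forall k, is_subspace (L k)) -> is_subspace (family_sum L).
Proof.
move=> Ls; split.
  exists 0%N, (fun=> 0); split=> [k|]; first exact: (subspace0 (Ls k)).
  by rewrite big_ord0.
move=> c _ _ [n [vs [Kvs ->]]] [p [ws [Kws ->]]].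
(* Padding with zeros brings two sums of different lengths to a common length. *)
pose cut q (us : nat -> V) k := if (k < q)%N then us k else 0.
have Kcut q us k : (forall k, L k (us k)) -> L k (cut q us k).
  by rewrite /cut; case: ifP => // *; apply: (subspace0 (Ls _)).
have cutE q (us : nat -> V) r : (q <= r)%N ->
    \sum_(k < q) us k = \sum_(k < r) cut q us k.
  by move=> qr; rewrite (big_ord_widen _ us qr) big_mkcond.
exists (maxn n p), (fun k => c *: cut n vs k + cut p ws k); split=> [k|].
  by apply: (Ls k).2; apply: Kcut.
rewrite (cutE n vs _ (leq_maxl n p)) (cutE p ws _ (leq_maxr n p)).
by rewrite scaler_sumr -big_split.
Qed.

Lemma set1_subspace (F : fieldType) (V : lmodType F) :
  is_subspace [set 0 : V].
Proof. by split=> // c v w -> ->; rewrite scaler0 addr0. Qed.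

(** Common form of [gl_infty] (with [P := predT]) and of [gl_S] (with [P := mem S]), so that one
    theory of highest weight modules serves for both L(S, U) and U^S. *)
Definition index_spanned (F : fieldType) (h : lieSubalg F) (P : pred int) :=
  forall x, lsub h x <-> mspan (fun m n => P m /\ P n) x.

Section Action.
Variables (F : fieldType) (h : lieSubalg F) (V : lieModule h).
Implicit Types (x : gl F) (v w : V).

Lemma lact0 x : lsub h x -> lact x (0 : V) = 0.
Proof. by move=> hx; apply: (linear_at0 (@lact_linear_r _ _ V x hx)). Qed.

Lemma lactD x v w : lsub h x -> lact x (v + w) = lact x v + lact x w.
Proof. by move=> hx; apply: (linearD_at (@lact_linear_r _ _ V x hx)). Qed.

Lemma lactZ x c v : lsub h x -> lact x (c *: v) = c *: lact x v.
Proof. by move=> hx; apply: (linearZ_at (@lact_linear_r _ _ V x hx)). Qed.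

Lemma lactB x v w : lsub h x -> lact x (v - w) = lact x v - lact x w.
Proof. by move=> hx; apply: (linear_sub _ _ (@lact_linear_r _ _ V x hx)). Qed.

Lemma lact_sum x (I : Type) (r : seq I) (Q : pred I) (f : I -> V) :
  lsub h x ->
  lact x (\sum_(i <- r | Q i) f i) = \sum_(i <- r | Q i) lact x (f i).
Proof. by move=> hx; apply: (linear_sum_at (@lact_linear_r _ _ V x hx)). Qed.

Lemma lact0l v : lact 0 v = 0.
Proof.
have h0 : lsub h 0 by have [[]] := lsub_subalgebra h.
by have := lact_linear_l (-1) v h0 h0; rewrite !scaleN1r oppr0 addr0 addNr.
Qed.

Lemma lactZl c x v : lsub h x -> lact (c *: x) v = c *: lact x v.
Proof.
move=> hx; have h0 : lsub h 0 by have [[]] := lsub_subalgebra h.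
by have := lact_linear_l c v hx h0; rewrite lact0l !addr0.
Qed.

Lemma lactBl x y v : lsub h x -> lsub h y ->
  lact (x - y) v = lact x v - lact y v.
Proof.
move=> hx hy; have := lact_linear_l (-1) v hy hx.
by rewrite !scaleN1r addrC => ->; rewrite addrC.
Qed.

Variables (P : pred int) (hP : index_spanned h P).

Lemma index_E m n : P m -> P n -> lsub h (E F m n).
Proof. by move=> Pm Pn; apply/hP/mspan_E. Qed.

Lemma lact_E m n r s v : P m -> P n -> P r -> P s ->
  lact (E F m n) (lact (E F r s) v) = lact (E F r s) (lact (E F m n) v) +
    ((n == r)%:R *: lact (E F m s) v - (m == s)%:R *: lact (E F r n) v).
Proof.
move=> Pm Pn Pr Ps; have hE := index_E.
have hZ := subspaceZ (lsub_subalgebra h).1.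
have := lact_bracket v (hE m n Pm Pn) (hE r s Pr Ps).
rewrite bracket_E lactBl; try by apply: hZ; apply: hE.
rewrite !lactZl; try by apply: hE.
by move=> ->; rewrite addrC subrK.
Qed.

Lemma submodule_units (K : set V) : is_subspace K ->
  (forall m n v, P m -> P n -> K v -> K (lact (E F m n) v)) -> is_submodule K.
Proof.
move=> Ks KE; split=> // x v /hP + Kv; elim=> [|c _ y [m [n [[Pm Pn] ->]]] hy IH].
  by rewrite lact0l; apply: subspace0.
rewrite lact_linear_l; [|exact: index_E|exact/hP].
by apply: Ks.2 => //; apply: KE.
Qed.

End Action.

Lemma sum_delta (F : fieldType) (S : {fset int}) (V : lmodType F)
    (f : int -> V) (m : int) :
  \sum_(n <- S) (n == m)%:R *: f n = (m \in S)%:R *: f m.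
Proof.
case: (boolP (m \in S)) => mS.
  rewrite (bigD1_seq m) ?fset_uniq //= eqxx big1 ?addr0 // => n /negbTE->.
  by rewrite scale0r.
rewrite big_seq big1 ?scale0r // => n nS; case: eqP => [nm|_].
  by rewrite -nm nS in mS.
by rewrite scale0r.
Qed.

(** * Layers below a top and the submodule that they form *)

Section Layers.
Variables (F : fieldType) (h : lieSubalg F) (P : pred int).
Hypothesis hP : index_spanned h P.
Variables (S : {fset int}) (SP : {subset S <= P}) (V : lieModule h).

(** The action of [I_S]. It is the Euler operator of the grading: by [euler_E], a unit shifts its
    eigenvalues by the degree of the unit. *)
Definition euler (v : V) : V := \sum_(n <- S) lact (E F n n) v.

Lemma euler_linear : linear euler.
Proof.
move=> c v w; rewrite /euler scaler_sumr -big_split /= !big_seq.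
apply: eq_bigr => n nS; rewrite lact_linear_r //.
by apply: (index_E hP); apply: SP.
Qed.

Lemma euler_submodule (K : set V) v : is_submodule K -> K v -> K (euler v).
Proof.
case=> Ks KE Kv; rewrite /euler big_seq; apply: subspace_sum => // n nS.
by apply: KE => //; apply: (index_E hP); apply: SP.
Qed.

Lemma euler_E a b v : P a -> P b -> euler (lact (E F a b) v) =
  lact (E F a b) (euler v) + ((a \in S)%:R - (b \in S)%:R) *: lact (E F a b) v.
Proof.
move=> Pa Pb; rewrite /euler lact_sum; last exact: (index_E hP).
have -> : ((a \in S)%:R - (b \in S)%:R) *: lact (E F a b) v =
  \sum_(n <- S) ((n == a)%:R *: lact (E F a b) v -
                 (n == b)%:R *: lact (E F a b) v).
  by rewrite sumrB !(sum_delta S (fun=> lact (E F a b) v)) scalerBl.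
rewrite -big_split /= !big_seq; apply: eq_bigr => n /SP Pn.
rewrite (lact_E hP) //; congr (_ + (_ - _)).
  by case: eqP => [->|]; rewrite ?scale0r.
by case: eqP => [->|]; rewrite ?scale0r.
Qed.

(* The degree 0 layer of a highest weight module. *)
Definition is_top (a : F) (K : set V) : Prop :=
  [/\ is_subspace K,
      forall m n v, m \in S -> n \in S -> K v -> K (lact (E F m n) v),
      forall m n v, P m -> P n -> n \notin S -> K v -> lact (E F m n) v = 0
    & forall v, K v -> euler v = a *: v].

(** Only units of degree -1 are applied here; how the other units move the layers is the content of
    [layer_act]. *)
Fixpoint layer (K : set V) (k : nat) : set V :=
  if k is k'.+1 then
    lspan [set w | exists m n v, [/\ P m, m \notin S, n \in S,
                                     layer K k' v & w = lact (E F m n) v]]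
  else K.

Definition gen_submod (K : set V) : set V := family_sum (layer K).

Variables (a : F) (K : set V) (topK : is_top a K).

Lemma layer_subspace k : is_subspace (layer K k).
Proof. by case: topK; case: k => [//|k] *; apply: lspan_subspace. Qed.

Lemma layer_lower k m n v : P m -> m \notin S -> n \in S -> layer K k v ->
  layer K k.+1 (lact (E F m n) v).
Proof. by move=> Pm mS nS Kv; apply: lspan_gen; exists m, n, v. Qed.

(** A unit is commuted past the last lowering unit, and the commutator has the sum of the two
    degrees. The two claims share one induction because the commutator of a raising and a lowering
    unit has degree 0. *)
Lemma layer_act k v : layer K k v ->
  (forall m n, P m -> P n -> (m \in S) = (n \in S) ->
     layer K k (lact (E F m n) v)) /\
  (forall m n, m \in S -> P n -> n \notin S ->
     if k is k'.+1 then layer K k' (lact (E F m n) v)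
     else lact (E F m n) v = 0).
Proof.
case: topK => Ks KS Kkill _.
elim: k v => [|k IH] v.
  move=> /= Kv; split=> [m n Pm Pn mnS|m n mS Pn nS]; last first.
    exact/Kkill/Kv/nS/Pn/SP.
  case: (boolP (n \in S)) => nS; first by apply: KS => //; rewrite mnS.
  by rewrite Kkill //; apply: subspace0.
have Ls := layer_subspace; have hE := index_E hP.
elim=> [|c _ w [x [b [y [Px xS bS Ky ->]]]] _ [IH0 IH1]].
  split=> [m n Pm Pn _|m n mS Pn _]; rewrite lact0; try exact: (subspace0 (Ls _)).
    exact: hE.
  by apply: hE => //; apply: SP.
have [IHy0 IHy1] := IH _ Ky; have Pb := SP bS.
split=> [m n Pm Pn mnS|m n mS Pn nS].
  rewrite lactD ?lactZ; try exact: hE.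
  apply: (subspaceD (Ls _)); last exact: IH0.
  apply: (subspaceZ (Ls _)); rewrite (lact_E hP) //.
  apply: (subspaceD (Ls _)); first by apply: layer_lower => //; apply: IHy0.
  apply: (subspaceB (Ls _)).
    case: eqP => [nx|_]; last by rewrite scale0r; apply: (subspace0 (Ls _)).
    by apply: (subspaceZ (Ls _)); apply: layer_lower => //; rewrite mnS nx.
  case: eqP => [mb|_]; last by rewrite scale0r; apply: (subspace0 (Ls _)).
  by apply: (subspaceZ (Ls _)); apply: layer_lower => //; rewrite -mnS mb.
have Pm := SP mS.
rewrite lactD ?lactZ; try exact: hE.
apply: (subspaceD (Ls _)); last exact: IH1.
apply: (subspaceZ (Ls _)); rewrite (lact_E hP) //.
apply: (subspaceD (Ls _)).
  (* On the top itself the raising unit gives 0; below it, the raising unit goes up one layer and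
     the lowering unit comes back. *)
  move: (IHy1 _ _ mS Pn nS) => {Ky IHy0 IHy1 IH0 IH1 IH}.
  case: k => [|k] Hy; last exact: layer_lower.
  by rewrite Hy lact0; [exact: (subspace0 (Ls 0)) | exact: hE].
apply: (subspaceB (Ls _)).
  case: eqP => [nx|_]; last by rewrite scale0r; apply: (subspace0 (Ls _)).
  by apply: (subspaceZ (Ls _)); apply: IHy0 => //; rewrite mS bS.
case: eqP => [mb|_]; last by rewrite scale0r; apply: (subspace0 (Ls _)).
by apply: (subspaceZ (Ls _)); apply: IHy0 => //; rewrite (negbTE xS) (negbTE nS).
Qed.

Lemma layer_euler k v : layer K k v -> euler v = (a - k%:R) *: v.
Proof.
case: topK => _ _ _ KI; elim: k v => [|k IH] v /=.
  by rewrite subr0; apply: KI.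
have eP := euler_linear.
elim=> [|c _ w [x [b [y [Px xS bS Ky ->]]]] _ IHw].
  by rewrite (linear_at0 eP) scaler0.
rewrite eP IHw scalerDr; congr (_ + _); rewrite scalerA mulrC -scalerA.
have Pb := SP bS; congr (_ *: _).
rewrite euler_E // (IH _ Ky) (negbTE xS) bS lactZ; last exact: (index_E hP).
by rewrite -scalerDl sub0r -addrA -opprD natr1.
Qed.

Lemma gen_layer k v : layer K k v -> gen_submod K v.
Proof.
move=> Kv; exists k.+1, (fun i => if i == k then v else 0); split=> [i|].
  by case: eqP => [->//|_]; apply: (subspace0 (layer_subspace _)).
rewrite big_ord_recr /= eqxx big1 ?add0r // => i _.
by rewrite ltn_eqF.
Qed.

Lemma gen_subspace : is_subspace (gen_submod K).
Proof. exact: family_sum_subspace layer_subspace. Qed.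

Lemma gen_submodule : is_submodule (gen_submod K).
Proof.
apply: (submodule_units hP); first exact: gen_subspace.
move=> m n _ Pm Pn [q [vs [Kvs ->]]]; rewrite lact_sum; last exact: (index_E hP).
apply: (subspace_sum gen_subspace) => k _; have [K0 K1] := layer_act (Kvs k).
case: (boolP (m \in S)) => mS; case: (boolP (n \in S)) => nS.
- by apply: (@gen_layer k); apply: K0; rewrite ?mS.
- have := K1 _ _ mS Pn nS; case: (nat_of_ord k) => [|k'] => [->|].
    exact: (subspace0 gen_subspace).
  exact: gen_layer.
- by apply: (@gen_layer k.+1); apply: layer_lower.
- by apply: (@gen_layer k); apply: K0; rewrite ?(negbTE mS) ?(negbTE nS).
Qed.

Lemma gen_min (L : set V) : is_submodule L -> K `<=` L -> gen_submod K `<=` L.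
Proof.
move=> [Ls LE] KL _ [n [vs [Kvs ->]]]; apply: subspace_sum => // k _.
have := Kvs k; elim: (nat_of_ord k) (vs k) => [|j IH] v; first exact: KL.
apply: lspan_min => // _ [m [b [y [Pm _ bS Ky ->]]]]; apply: LE (IH _ Ky).
by apply: (index_E hP) => //; apply: SP.
Qed.

Hypothesis natI : injective (fun k : nat => k%:R : F).

Lemma layer_eigenvalue_inj : injective (fun k : nat => a - k%:R).
Proof. by move=> i j /addrI /oppr_inj /natI. Qed.

Lemma layer_components (L : set V) n (vs : nat -> V) :
  is_subspace L -> (forall v, L v -> L (euler v)) ->
  (forall k, layer K k (vs k)) -> L (\sum_(k < n) vs k) ->
  forall k, (k < n)%N -> L (vs k).
Proof.
move=> Ls LI Kvs; apply: (eigen_components Ls) LI layer_eigenvalue_inj _.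
  exact: euler_linear.
by move=> k; apply: layer_euler.
Qed.

(** The components of [v] satisfy [(a - k - c) *: vs k = 0] separately, and the numbers [a - k] are
    distinct, so at most one component survives. *)
Lemma gen_eigen v c : gen_submod K v -> euler v = c *: v ->
  v = 0 \/ exists2 k : nat, c = a - k%:R & layer K k v.
Proof.
move=> [n [vs [Kvs ->]]] vE.
have comp0 k : (k < n)%N -> (a - k%:R - c) *: vs k = 0.
  move=> kn; pose ws k := (a - k%:R - c) *: vs k.
  (* For the zero subspace, [layer_components] is the linear independence of the layers. *)
  apply: (@layer_components [set 0] n ws) => //.
  - exact: set1_subspace.
  - by move=> _ ->; apply: (linear_at0 euler_linear).
  - by move=> j; apply: (subspaceZ (layer_subspace _)).
  rewrite /= /ws; move: vE => /eqP; rewrite -subr_eq0.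
  have eP := euler_linear.
  have -> : euler (\sum_(k < n) vs k) = \sum_(k < n) (a - k%:R) *: vs k.
    by rewrite (linear_sum_at eP); apply: eq_bigr => i _; apply: layer_euler.
  rewrite scaler_sumr -sumrB => /eqP sum0; rewrite -[RHS]sum0.
  by apply: eq_bigr => i _; rewrite scalerBl.
case: (pselect (exists2 k, (k < n)%N & c = a - k%:R)) => [[k kn cE]|ncE].
  right; exists k => //; rewrite (bigD1 (Ordinal kn)) //= big1 ?addr0 // => i ik.
  have /eqP := comp0 i (ltn_ord i); rewrite scaler_eq0 => /orP[|/eqP //].
  rewrite cE subr_eq0 => /eqP /layer_eigenvalue_inj ikE.
  by rewrite -val_eqE /= ikE eqxx in ik.
left; rewrite big1 // => i _.
have /eqP := comp0 i (ltn_ord i); rewrite scaler_eq0 => /orP[|/eqP //].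
by rewrite subr_eq0 => /eqP cE; case: ncE; exists i.
Qed.

(** The top is recovered as the full [a]-eigenspace of what it generates. Every later identification
    of a top rests on this. *)
Lemma gen_top v : gen_submod K v -> euler v = a *: v -> K v.
Proof.
move=> Kv /(gen_eigen Kv) [->|[k aE]].
  by case: topK => Ks *; apply: subspace0.
suff -> : k = 0%N by [].
by apply: layer_eigenvalue_inj; rewrite /= -aE subr0.
Qed.

End Layers.

Lemma gl_sub_spanned (F : fieldType) (S : {fset int}) :
  index_spanned (gl_sub F S) (mem S).
Proof. by []. Qed.

Lemma gl_full_spanned (F : fieldType) : index_spanned (gl_full F) predT.
Proof.
move=> x; split=> // _; elim/fm_ind: x => [|c [m n] x IH]; first exact: lspan0.
by apply: lspanS IH; exists m, n.
Qed.

Section ProductModule.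
Variables (F : fieldType) (h : lieSubalg F) (V W : lieModule h).

Let prod_act (x : gl F) (p : (V * W)%type) : (V * W)%type :=
  (lact x p.1, lact x p.2).

Fact prod_act_linear_l c x y p : lsub h x -> lsub h y ->
  prod_act (c *: x + y) p = c *: prod_act x p + prod_act y p.
Proof.
move=> hx hy; rewrite /prod_act.
by rewrite (lact_linear_l _ p.1 hx hy) (lact_linear_l _ p.2 hx hy).
Qed.

Fact prod_act_linear_r x : lsub h x -> linear (prod_act x).
Proof.
move=> hx c p q; rewrite /prod_act /=.
by rewrite (lact_linear_r hx c p.1) (lact_linear_r hx c p.2).
Qed.

Fact prod_act_bracket x y p : lsub h x -> lsub h y ->
  prod_act (bracket x y) p =
  prod_act x (prod_act y p) - prod_act y (prod_act x p).
Proof.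
move=> hx hy; rewrite /prod_act /=.
by rewrite (lact_bracket p.1 hx hy) (lact_bracket p.2 hx hy).
Qed.

Definition prod_module : lieModule h :=
  LieModule prod_act_linear_l prod_act_linear_r prod_act_bracket.

Lemma prod_lactE x (v : V) (w : W) :
  lact x ((v, w) : prod_module) = (lact x v, lact x w).
Proof. by []. Qed.

End ProductModule.

Lemma linear_map (F : fieldType) (V W : lmodType F) (f : V -> W) :
  linear f -> exists phi : {linear V -> W}, phi =1 f.
Proof.
move=> flin; pose phi : {linear V -> W} :=
  HB.pack f (GRing.isLinear.Build F V W *:%R f flin).
by exists phi.
Qed.

(** * Extending a map of tops to a map of modules *)

Section HighestWeight.
Variables (F : fieldType) (h : lieSubalg F) (P : pred int) (S : {fset int}).
Hypotheses (hP : index_spanned h P) (SP : {subset S <= P}).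
Hypothesis natI : injective (fun k : nat => k%:R : F).
Variable U : lieModule (gl_sub F S).

(** A homomorphism over the parabolic subalgebra, where the units whose second index is outside [S]
    act on [U] by 0. Injectivity is not built in: for irreducible [U] it follows from being
    nonzero. *)
Definition hw_map (V : lieModule h) (j : U -> V) : Prop :=
  [/\ linear j,
      forall m n u, m \in S -> n \in S ->
        j (lact (E F m n) u) = lact (E F m n) (j u)
    & forall m n u, P m -> P n -> n \notin S -> lact (E F m n) (j u) = 0].

Definition euler_scalar (a : F) : Prop := forall u : U, euler S u = a *: u.

Lemma hw_map0 (V : lieModule h) (j : U -> V) : hw_map j -> j 0 = 0.
Proof. by case=> jlin _ _; apply: linear_at0. Qed.

Lemma hw_map_injective (V : lieModule h) (j : U -> V) :
  irreducible U -> hw_map j -> (exists u, j u <> 0) ->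
  forall u, j u = 0 -> u = 0.
Proof.
move=> [_ irrU] hwj [u0 ju0]; have j0 := hw_map0 hwj; case: hwj => jlin jE _.
have hE := index_E hP; have kerj : is_submodule [set u | j u = 0].
  apply: (submodule_units (@gl_sub_spanned F S)).
    by split=> //= c v w jv jw; rewrite jlin jv jw scaler0 addr0.
  move=> m n v mS nS /= jv; rewrite jE // jv lact0 //.
  by apply: hE; apply: SP.
move=> u ju; have [ker|ker] := irrU _ kerj.
  by have : [set u | j u = 0] u by []; rewrite ker.
by case: ju0; have : setT u0 by []; rewrite -ker.
Qed.

Variable a : F.
Hypotheses (irrU : irreducible U) (aU : euler_scalar a).

Lemma hw_top (V : lieModule h) (j : U -> V) :
  hw_map j -> is_top P S a (range j).
Proof.
move=> hwj; have j0 := hw_map0 hwj; have [jlin jE jk] := hwj; split.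
- split; first by exists 0.
  by move=> c _ _ [u _ <-] [v _ <-]; exists (c *: u + v); rewrite ?jlin.
- by move=> m n _ mS nS [u _ <-]; exists (lact (E F m n) u) => //; apply: jE.
- by move=> m n _ Pm Pn nS [u _ <-]; apply: jk.
move=> _ [u _ <-]; rewrite -(linearZ_at jlin) -aU /euler (linear_sum_at jlin).
by rewrite !big_seq; apply: eq_bigr => n nS; rewrite jE.
Qed.

(** The target [V'] is not assumed irreducible; the last hypothesis asks this only of the submodule
    generated by its top. This form is needed in [hw_enlarge], where [V'] is the restriction to
    [gl_S] of a [gl_infty]-module. *)
Lemma hw_extend (V V' : lieModule h) (j : U -> V) (j' : U -> V') :
  irreducible V -> hw_map j -> hw_map j' ->
  (exists u, j u <> 0) -> (exists u, j' u <> 0) ->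
  (forall K : set V', is_submodule K -> K `<=` gen_submod P S (range j') ->
     K = [set 0] \/ gen_submod P S (range j') `<=` K) ->
  exists phi : {linear V -> V'},
    [/\ injective phi,
        forall x v, lsub h x -> phi (lact x v) = lact x (phi v),
        forall u, phi (j u) = j' u
      & range phi = gen_submod P S (range j')].
Proof.
move=> [_ irrV] hwj hwj' j_neq0 j'_neq0 irrV'.
have jK := hw_map_injective irrU hwj j_neq0.
have j'K := hw_map_injective irrU hwj' j'_neq0.
have j0 := hw_map0 hwj; have j'0 := hw_map0 hwj'.
pose W := prod_module V V'; pose d u : W := (j u, j' u).
have hwd : @hw_map W d.
  case: hwj hwj' => [jlin jE jk] [j'lin j'E j'k]; split.
  - by move=> c u v; rewrite /d jlin j'lin.
  - by move=> m n u mS nS; rewrite /d jE // j'E.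
  - by move=> m n u Pm Pn nS; rewrite prod_lactE jk // j'k.
have topd := hw_top hwd; have topj' := hw_top hwj'.
(* the graph of the isomorphism *)
pose G : set W := gen_submod P S (range d).
have [Gs GE] : is_submodule G := gen_submodule hP SP topd.
have Gd u : G (d u) by apply: (@gen_layer _ _ _ _ _ _ _ topd 0%N); exists u.
have hE := index_E hP.
have Gtop (w : W) : G w -> euler S w = a *: w -> exists u, w = d u.
  by move=> Gw wa; have [u _ <-] := gen_top hP SP topd natI Gw wa; exists u.
have eulerW (v : V) (v' : V') : euler S ((v, v') : W) = (euler S v, euler S v').
  rewrite /euler; elim: (enum_fset S) => [|n r IH]; first by rewrite !big_nil.
  by rewrite !big_cons IH.
have eulerj (X : lieModule h) (i : U -> X) u :
    hw_map i -> euler S (i u) = a *: i u.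
  by move=> /hw_top [_ _ _ ->//]; exists u.
have euler0 (X : lieModule h) : euler S (0 : X) = 0.
  by rewrite /euler big_seq big1 // => n /SP Pn; rewrite lact0 //; apply: hE.
have domG v : exists v', G (v, v').
  pose D : set V := [set v | exists v', G (v, v')].
  have Dsub : is_submodule D.
    split; first split.
    - by exists 0; apply: (subspace0 Gs).
    - move=> c v1 v2 [v1' G1] [v2' G2]; exists (c *: v1' + v2').
      exact: (Gs.2 c _ _ G1 G2).
    - by move=> x v1 hx [v1' G1]; exists (lact x v1'); apply: (GE x _ hx G1).
  have [D0|DT] := irrV _ Dsub; last by have : setT v by []; rewrite -DT.
  have [u ju] := j_neq0; case: ju.
  by have : D (j u) by [exists (j' u); apply: Gd]; rewrite D0.
have subG v v' : G (v, v') -> gen_submod P S (range j') v'.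
  have [gs gE] := gen_submodule hP SP topj'.
  pose L : set W := [set w | gen_submod P S (range j') w.2].
  have Lsub : is_submodule L.
    split; first split.
    - exact: (subspace0 gs).
    - by move=> c w1 w2 L1 L2; apply: gs.2.
    - by move=> x w hx Lw; apply: (gE x _ hx Lw).
  move=> /(gen_min hP SP Lsub); apply=> _ [u _ <-].
  by apply: (@gen_layer _ _ _ _ _ _ _ topj' 0%N); exists u.
(* Otherwise [G] would contain all vectors [(0, j' u)]. Such a vector has eigenvalue [a], so it lies
   on the diagonal copy of [U], and injectivity of [j] makes it 0. The other axis is handled in the
   same way in [injG]. *)
have funG v' : G (0, v') -> v' = 0.
  pose N : set V' := [set v' | G (0, v')].
  have Nsub : is_submodule N.
    split; first split.
    - exact: (subspace0 Gs).
    - move=> c v1 v2 N1 N2; have := Gs.2 c _ _ N1 N2.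
      have -> : c *: ((0, v1) : W) + (0, v2) = (0, c *: v1 + v2); last by [].
      by rewrite [LHS]surjective_pairing /= scaler0 addr0.
    - by move=> x v hx Nv; have := GE x _ hx Nv; rewrite prod_lactE lact0.
  move=> Nv'; have [N0|gN] := irrV' _ Nsub (fun v => @subG 0 v).
    by have : N v' by []; rewrite N0.
  have [u j'u] := j'_neq0; case: j'u.
  have N1 : N (j' u).
    by apply: gN; apply: (@gen_layer _ _ _ _ _ _ _ topj' 0%N); exists u.
  have [|u' [/esym/jK u'0 ->]] := Gtop _ N1; last by rewrite u'0.
  rewrite eulerW euler0 eulerj //; by congr pair; rewrite scaler0.
have injG v : G (v, 0) -> v = 0.
  pose N : set V := [set v | G (v, 0)].
  have Nsub : is_submodule N.
    split; first split.
    - exact: (subspace0 Gs).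
    - move=> c v1 v2 N1 N2; have := Gs.2 c _ _ N1 N2.
      have -> : c *: ((v1, 0) : W) + (v2, 0) = (c *: v1 + v2, 0); last by [].
      by rewrite [LHS]surjective_pairing /= scaler0 addr0.
    - by move=> x w hx Nw; have := GE x _ hx Nw; rewrite prod_lactE lact0.
  move=> Nv; have [N0|NT] := irrV _ Nsub; first by have : N v by []; rewrite N0.
  have [u ju] := j_neq0; case: ju.
  have N1 : N (j u) by rewrite NT.
  have [|u' [-> /esym/j'K u'0]] := Gtop _ N1; last by rewrite u'0.
  rewrite eulerW euler0 eulerj //; by congr pair; rewrite scaler0.
have [f fG] := choice domG.
have uniqG v v1 v2 : G (v, v1) -> G (v, v2) -> v1 = v2.
  move=> G1 G2; apply/eqP; rewrite -subr_eq0; apply/eqP/funG.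
  by have := subspaceB Gs G1 G2; rewrite [_ - _]surjective_pairing /= subrr.
have flin : linear f.
  by move=> c v w; apply: uniqG (fG _) (Gs.2 c _ _ (fG v) (fG w)).
have [phi phiE] := linear_map flin; exists phi; split.
- move=> v w; rewrite !phiE => fvw; apply/eqP; rewrite -subr_eq0.
  apply/eqP/injG; have := subspaceB Gs (fG v) (fG w).
  by rewrite [_ - _]surjective_pairing /= fvw subrr.
- by move=> x v hx; rewrite !phiE; apply: uniqG (fG _) (GE x _ hx (fG v)).
- by move=> u; rewrite phiE; apply: uniqG (fG _) (Gd u).
apply/seteqP; split=> [_ [v _ <-]|]; first by rewrite phiE; apply: subG (fG v).
have Isub : is_submodule (range phi).
  split; first split.
  - by exists 0 => //; rewrite linear0.
  - by move=> c _ _ [v _ <-] [w _ <-]; exists (c *: v + w); rewrite ?linearP.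
  - move=> x _ hx [v _ <-]; exists (lact x v) => //.
    by rewrite !phiE; apply: uniqG (fG _) (GE x _ hx (fG v)).
apply: (gen_min hP SP Isub) => _ [u _ <-]; exists (j u) => //.
by rewrite phiE; apply: uniqG (fG _) (Gd u).
Qed.

End HighestWeight.

Lemma sub_predT (S : {fset int}) : {subset S <= predT}.
Proof. by []. Qed.

Section RestrictModule.
Variables (F : fieldType) (h h' : lieSubalg F) (hh : h' `<=` h).
Variable V : lieModule h.

Definition restrict_module : lieModule h' :=
  @LieModule F h' V (@lact _ _ V)
    (fun c x y v hx hy => lact_linear_l c v (hh hx) (hh hy))
    (fun x hx => lact_linear_r (hh hx))
    (fun x y v hx hy => lact_bracket v (hh hx) (hh hy)).

End RestrictModule.

Lemma bijective_of_range (T T' : Type) (f : T -> T') :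
  injective f -> range f = setT -> bijective f.
Proof.
move=> finj fT; have /choice [g gK] : forall y, exists x, f x = y.
  by move=> y; have [x _ <-] : range f y by [rewrite fT]; exists x.
by exists g => // x; apply: finj.
Qed.

Lemma lie_iso_same_range (F : fieldType) (h h' : lieSubalg F)
    (A B : lieModule h') (X : lieModule h) (f : {linear A -> X})
    (g : {linear B -> X}) :
  injective f -> injective g -> range f = range g ->
  (forall x u, lsub h' x -> f (lact x u) = lact x (f u)) ->
  (forall x u, lsub h' x -> g (lact x u) = lact x (g u)) ->
  lie_iso A B.
Proof.
move=> finj ginj fg fE gE.
have /choice [k kE] : forall u, exists w, g w = f u.
  by move=> u; have [w _ <-] : range g (f u) by [rewrite -fg; exists u]; exists w.
have klin : linear k.
  by move=> c u v; apply: ginj; rewrite linearP !kE linearP.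
have [phi phiE] := linear_map klin; exists phi; split.
  apply: bijective_of_range => [u v|].
    by rewrite !phiE => kuv; apply: finj; rewrite -!kE kuv.
  apply/seteqP; split=> // w _; have [u _ fu] : range f (g w).
    by rewrite fg; exists w.
  by exists u => //; apply: ginj; rewrite phiE kE.
by move=> x v hx; apply: ginj; rewrite gE // !phiE !kE fE.
Qed.

(** * The quotient of a highest weight module by its proper submodules *)

Section Quotient.
Variables (F : fieldType) (h : lieSubalg F) (P : pred int) (S : {fset int}).
Hypotheses (hP : index_spanned h P) (SP : {subset S <= P}).
Hypothesis natI : injective (fun k : nat => k%:R : F).
Variables (U : lieModule (gl_sub F S)) (a : F).
Hypotheses (irrU : irreducible U) (aU : euler_scalar U a).
Variables (V : lieModule h) (j : U -> V).
Hypotheses (hwj : hw_map P j) (j_neq0 : exists u, j u <> 0).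
Hypothesis jgen : forall L : set V, is_submodule L -> range j `<=` L -> L = setT.

Lemma proper_top (K : set V) u :
  is_submodule K -> K <> setT -> K (j u) -> u = 0.
Proof.
move=> [Ks KE] KT Kju; have j0 := hw_map0 hwj; have [jlin jE _] := hwj.
pose Uk : set U := [set u | K (j u)].
have Uksub : is_submodule Uk.
  apply: (submodule_units (@gl_sub_spanned F S)).
    split=> [|c u1 u2 K1 K2]; first by rewrite /Uk /= j0; apply: (subspace0 Ks).
    by rewrite /Uk /= jlin; apply: Ks.2.
  move=> m p u1 mS pS K1; rewrite /Uk /= jE //; apply: KE => //.
  by apply: (index_E hP); apply: SP.
have [Uk0|UkT] := irrU.2 _ Uksub; first by have : Uk u by []; rewrite Uk0.
case: KT; apply: jgen => // _ [u1 _ <-].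
by have : setT u1 by []; rewrite -UkT.
Qed.

(** The hypotheses below say that this is the set of all proper submodules. It is a variable because
    [L_mod] is built from [M_small], which is identified with this set only in [L_mod_hw]. *)
Variable proper : set (set V).
Hypothesis proper_sub : forall K, proper K -> is_submodule K.
Hypothesis properT : forall K, proper K -> K <> setT.
Hypothesis properP : forall K, is_submodule K -> K <> setT -> proper K.

Let topj : is_top P S a (range j) := hw_top aU hwj.
(** A complement of the top. A sum of proper submodules could a priori be everything; it is not,
    because each of them lies in this one proper subspace. *)
Let lower : set V := family_sum (fun k => layer P S (range j) k.+1).

Fact lower_subspace : is_subspace lower.
Proof. by apply: family_sum_subspace => k; apply: (layer_subspace topj k.+1). Qed.

Fact lower_top u : lower (j u) -> j u = 0.
Proof.
have Ls := layer_subspace topj.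
(* The equation for [j u] becomes a vanishing sum with [- j u] in layer 0 and [vs k] in layer
   [k.+1], so independence of the layers applies. *)
move=> [n [vs [Kvs juE]]]; pose ws k := if k is k'.+1 then vs k' else - j u.
suff : [set 0] (ws 0%N) by move=> /= /eqP; rewrite oppr_eq0 => /eqP.
apply: (@layer_components _ _ _ hP _ SP _ _ _ topj natI [set 0] n.+1 ws) => //.
- exact: set1_subspace.
- move=> _ ->; rewrite /euler big_seq big1 // => i /SP Pi.
  by rewrite lact0 //; apply: (index_E hP).
- case=> [|k] /=; last exact: Kvs.
  by rewrite -scaleN1r; apply: (subspaceZ (Ls 0%N)); exists u.
by rewrite /= big_ord_recl /= juE addNr.
Qed.

(** Being stable under [I_S], the submodule [K] contains the layer components of its vectors, and by
    [proper_top] the component in the top is 0. *)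
Fact proper_lower K : proper K -> K `<=` lower.
Proof.
move=> PK v Kv; have Ksub := proper_sub PK; have [Ks KE] := Ksub.
have j0 := hw_map0 hwj; have [jlin jE _] := hwj.
have [n [vs [Kvs vE]]] : gen_submod P S (range j) v.
  rewrite (jgen (gen_submodule hP SP topj)) // => w rw.
  exact: (@gen_layer _ _ _ _ _ _ _ topj 0%N).
case: n vE => [|n] vE.
  by rewrite vE big_ord0; apply: (subspace0 lower_subspace).
have Kvs0 : K (vs 0%N).
  apply: (layer_components hP SP topj natI Ks) Kvs _ _ (ltn0Sn n).
    by move=> w; apply: (euler_submodule hP SP Ksub).
  by rewrite -vE.
have [u _ uE] := Kvs 0%N.
have u0 : u = 0.
  by apply: (proper_top Ksub (properT PK)); rewrite uE.
exists n, (fun k => vs k.+1); split=> [k|]; first exact: Kvs.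
by rewrite vE big_ord_recl -uE u0 j0 add0r.
Qed.

Fact sum_of_lower v : sum_of proper v -> lower v.
Proof.
apply: lspan_min; first exact: lower_subspace.
by move=> w [K PK Kw]; apply: proper_lower PK _ Kw.
Qed.

(** The top survives since the sum of the proper submodules stays in [lower]. A submodule of the
    quotient whose preimage is proper is 0, that preimage being one of the summands. *)
Lemma quotient_hw (Q := quotient_module (sum_of_submodule proper_sub)) :
  [/\ irreducible Q, @hw_map _ h P S U Q (qpi (sum_of proper) \o j)
    & exists u, qpi (sum_of proper) (j u) <> 0].
Proof.
have j0 := hw_map0 hwj; have [jlin jE jk] := hwj.
pose J := sum_of proper; have Jsub := sum_of_submodule proper_sub.
have actE := quo_actE Jsub.
have hE := index_E hP.
have qpi0 v : qpi J v = 0 <-> J v.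
  rewrite -[X in _ = X](linear0 (qpi J)) qpiP subr0; split; last exact: lspan_gen.
  by apply: lspan_min => //; case: Jsub.
have qj_neq0 : exists u, qpi J (j u) <> 0.
  have [u ju] := j_neq0; exists u => /qpi0 /sum_of_lower /lower_top; exact: ju.
split=> //; last first.
  split=> [c u v|m n u mS nS|m n u Pm Pn nS].
  - by rewrite /= jlin linearP.
  - by rewrite /= jE // -actE //; apply: hE; apply: SP.
  - by rewrite /= [LHS]actE ?jk ?linear0 //; apply: hE.
split; first by have [u uP] := qj_neq0; exists (qpi J (j u)).
move=> L [Ls LE]; pose L' : set V := [set v | L (qpi J v)].
have L'sub : is_submodule L'.
  split; first split.
  - by rewrite /L' /= linear0; apply: (subspace0 Ls).
  - by move=> c v w Lv Lw; rewrite /L' /= linearP; apply: Ls.2.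
  - by move=> x v hx Lv; rewrite /L' /= -actE //; apply: LE.
have [L'T|L'T] := pselect (L' = setT).
  right; apply/seteqP; split=> // m _; rewrite -[m]qreprK.
  by have : setT (qrepr m) by []; rewrite -L'T.
left; apply/seteqP; split=> [m Lm|_ ->]; last exact: (subspace0 Ls).
rewrite -[m]qreprK; apply/qpi0/lspan_gen; exists L'; first exact: properP.
by rewrite /L' /= qreprK.
Qed.

End Quotient.

(** * From a top over [S1] to a top over [S] *)

Section Enlarge.
Variables (F : fieldType) (S1 S : {fset int}) (sS : (S1 `<=` S)%fset).
Hypothesis natI : injective (fun k : nat => k%:R : F).
Variables (U : lieModule (gl_sub F S1)) (a : F).
Hypotheses (irrU : irreducible U) (aU : euler_scalar U a).
Variables (Q : lieModule (gl_full F)) (X : lieModule (gl_sub F S)).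
Hypotheses (irrQ : irreducible Q) (irrX : irreducible X).
Variables (j : U -> Q) (i : U -> X).
Hypotheses (hwj : hw_map predT j) (j_neq0 : exists u, j u <> 0).
Hypotheses (hwi : hw_map (mem S) i) (i_neq0 : exists u, i u <> 0).

(** Realises [X], later U1^S, as the top over [S] of [Q], later L(S1, U1), with the same scalar [a].
    This puts the two modules to be compared over one common index set. *)
Lemma hw_enlarge : exists phi : {linear X -> Q},
  [/\ injective phi, hw_map predT phi, euler_scalar X a
    & forall x u, lsub (gl_sub F S) x -> phi (lact x u) = lact x (phi u)].
Proof.
have fullP := @gl_full_spanned F; have subP := @gl_sub_spanned F S.
have hE m n : lsub (gl_full F) (E F m n) by [].
have S1S : {subset S1 <= mem S} by apply/fsubsetP.
pose Qr : lieModule (gl_sub F S) :=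
  @restrict_module F (gl_full F) (gl_sub F S) (@subsetT _ _) Q.
have hwr : @hw_map _ _ (mem S) S1 U Qr j.
  by have [jlin jE jk] := hwj; split=> // m n u _ _; apply: jk.
pose K : set Qr := gen_submod (mem S) S1 (range j).
have topr := hw_top aU hwr.
have [Ks KE] : is_submodule K := gen_submodule subP S1S topr.
have Kmin := gen_min subP S1S.
(* The common kernel of the units with second index outside [S], and the [a]-eigenspace of [I_S],
   are both stable under [gl_S]; so the last two conditions need checking only on [range j]. *)
have topK : @is_top F (gl_full F) predT S Q a K.
  split=> // [m n v mS nS Kv|m n v _ _ nS Kv|v Kv].
  - by apply: KE Kv; apply: (index_E subP).
  - pose N : set Qr :=
      [set v | forall m n, n \notin S -> lact (E F m n) (v : Q) = 0].
    have Nsub : is_submodule N.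
      apply: (submodule_units subP).
        split=> [p q _|c v1 v2 N1 N2 p q qS]; first exact: lact0.
        by rewrite lactD // lactZ // N1 // N2 // scaler0 addr0.
      move=> p q w pS qS Nw m' n' n'S; rewrite (lact_E fullP) // (Nw m' n') //.
      rewrite lact0 // (Nw p n') // scaler0 subr0 add0r.
      case: eqP => [n'p|]; last by rewrite scale0r.
      by case/negP: n'S; rewrite n'p; apply: pS.
    apply: (Kmin _ _ _ Nsub) Kv _ _ nS => _ [u _ <-] p q qS.
    by have [_ _ jk] := hwj; apply: jk => //; apply: contra qS; apply: S1S.
  - pose N : set Qr := [set v | euler S (v : Q) = a *: v].
    have eP := @euler_linear _ _ _ fullP S (@sub_predT S) Q.
    have Nsub : is_submodule N.
      apply: (submodule_units subP).
        split=> [|c v1 v2 N1 N2].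
          rewrite /N /= scaler0 /euler big1 // => n _; exact: lact0.
        by rewrite /N /= eP N1 N2 scalerDr !scalerA mulrC.
      move=> p q w pS qS Nw; rewrite /N /= (euler_E fullP (@sub_predT S)) //.
      by rewrite [p \in S]pS [q \in S]qS subrr scale0r addr0 Nw lactZ.
    apply: (Kmin _ _ _ Nsub) Kv => _ [u _ <-].
    have [_ _ jk] := hwj; have [_ _ _ jI] := hw_top aU hwj.
    rewrite /N /= -jI; last by exists u.
    (* On [range j] the operators [I_S] and [I_S1] agree, as [E n n] with [n] outside [S1] acts
       there by 0. *)
    rewrite /euler; symmetry; apply: big_fset_incl => // n _ nS1.
    exact: jk.
(* A [gl_S]-submodule of [K] is again a top for [gl_infty]. If it generates [Q], it is the whole
   [a]-eigenspace and so contains [K]. *)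
have irrK (L : set Qr) : is_submodule L -> L `<=` K -> L = [set 0] \/ K `<=` L.
  move=> [Ls LE] LK; have [K's KS Kk KI] := topK.
  have topL : @is_top F (gl_full F) predT S Q a L.
    split=> // [m n v mS nS Lv|m n v Pm Pn nS /LK Kv|v /LK Kv].
    - by apply: LE Lv; apply: (index_E subP).
    - exact: Kk.
    - exact: KI.
  have [gL0|gLT] := irrQ.2 _ (gen_submodule fullP (@sub_predT S) topL).
    left; apply/seteqP; split=> [v Lv|_ ->]; last exact: (subspace0 Ls).
    have : gen_submod predT S (L : set Q) v.
      exact: (@gen_layer _ _ _ _ _ _ _ topL 0%N).
    by rewrite gL0.
  right=> v Kv; apply: (gen_top fullP (@sub_predT S) topL natI); last exact: KI.
  by rewrite gLT.
have [phi [phi_inj phiE phij phiK]] :=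
  hw_extend subP S1S natI irrU aU irrX hwi hwr i_neq0 j_neq0 irrK.
have Kphi u : K (phi u) by have : range phi (phi u) by [exists u]; rewrite phiK.
exists phi; split=> //.
  split=> [c u v|m n u mS nS|m n u Pm Pn nS]; first exact: linearP.
    by rewrite phiE //; apply: (index_E subP).
  by have [_ _ Kk _] := topK; apply: Kk.
move=> u; apply: phi_inj; rewrite linearZ /=.
have [_ _ _ <-//] := topK; rewrite /euler linear_sum !big_seq.
by apply: eq_bigr => n nS; rewrite phiE //; apply: (index_E subP).
Qed.

End Enlarge.

(** * Action of the enveloping algebra *)

Lemma mulZDl (F : fieldType) (A : algType F) c (x y z : A) :
  (c *: x + y) * z = c *: (x * z) + y * z.
Proof. by rewrite mulrDl scalerAl. Qed.

Lemma mulZDr (F : fieldType) (A : algType F) c (x y z : A) :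
  x * (c *: y + z) = c *: (x * y) + x * z.
Proof. by rewrite mulrDr scalerAr. Qed.

Section EnvelopingAction.
Variables (F : fieldType) (h : lieSubalg F) (W : lieModule h).
Local Notation falg := (free_alg F (gl F)).

Lemma free_alg_ind (Q : falg -> Prop) : Q 0 ->
  (forall c m a, Q a -> Q (c *: (<< m >> : falg) + a)) -> forall a, Q a.
Proof.
move=> Q0 QS; apply: (@fm_ind F {fmonom gl F}) => [|c m x Qx].
  by rewrite -[0]/(fm_zero _ _) fm_zero.unlock.
rewrite fm_addE -[c *: _]/(fm_scale c _) fm_scale.unlock fm_basis.unlock.
exact: QS.
Qed.

(* Generators outside [h] vanish in the enveloping algebra of [h]. *)
Definition gen_act (x : gl F) (w : W) : W :=
  if `[< lsub h x >] then lact x w else 0.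

Definition word_act (m : {fmonom gl F}) (w : W) : W := foldr gen_act w m.

Definition free_act (a : falg) (w : W) : W :=
  lext (fun m => word_act m w) (a : freemod F {fmonom gl F}).

Lemma gen_actE x w : lsub h x -> gen_act x w = lact x w.
Proof. by rewrite /gen_act => /asboolP->. Qed.

Lemma word_act_linear m : linear (word_act m).
Proof.
move=> c v w; rewrite /word_act; elim: (m : seq _) => [//|x s IH] /=.
rewrite IH /gen_act; case: asboolP => [hx|_]; first by rewrite lact_linear_r.
by rewrite scaler0 addr0.
Qed.

Lemma free_act_linear_l w : linear (free_act^~ w).
Proof.
move=> c a b; rewrite /free_act -linearP; congr (lext _ _).
by rewrite fm_addE -[c *: _ in RHS]/(fm_scale c _) fm_scale.unlock.
Qed.

Lemma free_act0 w : free_act 0 w = 0.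
Proof. exact: (linear_at0 (free_act_linear_l w)). Qed.

Lemma free_actU m w : free_act << m >> w = word_act m w.
Proof.
by rewrite -(@lextU _ _ _ (fun m => word_act m w) m) fm_basis.unlock.
Qed.

Lemma free_act_linear_r a : linear (free_act a).
Proof.
elim/free_alg_ind: a => [|d m a IH] c v w.
  by rewrite !free_act0 scaler0 addr0.
rewrite !free_act_linear_l IH !free_actU word_act_linear !scalerDr !scalerA.
by rewrite [d * c]mulrC !addrA; congr (_ + _); rewrite -!addrA [_ + c *: _]addrC.
Qed.

Lemma free_actM a b w : free_act (a * b) w = free_act a (free_act b w).
Proof.
elim/free_alg_ind: a => [|c m a IH]; first by rewrite mul0r !free_act0.
rewrite [_ * b]mulZDl.
apply: etrans (free_act_linear_l w c _ _) _.
apply: etrans (esym (free_act_linear_l _ c _ _)).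
refine (congr2 (fun x y => c *: x + y) _ IH).
elim/free_alg_ind: b {IH} => [|d n b IH].
  by rewrite mulr0 !free_act0 (linear_at0 (free_act_linear_r << m >>)).
rewrite [_ * _]mulZDr.
apply: etrans (free_act_linear_l w d _ _) _.
rewrite [in RHS](free_act_linear_l w d << n >> b).
apply: etrans (esym (free_act_linear_r << m >> d _ _)).
refine (congr2 (fun x y => d *: x + y) _ IH).
by rewrite malgM_def fgmulUU mulr1 !free_actU /word_act fmM foldr_cat.
Qed.

Lemma free_act1 w : free_act 1 w = w.
Proof.
by rewrite -[1]/(<< fmone (gl F) >> : falg) free_actU /word_act fmoneE.
Qed.

Lemma free_act_gen x w : free_act (free_gen F x) w = gen_act x w.
Proof. by rewrite /free_gen free_actU /word_act fmuE. Qed.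

Lemma free_actB a b w : free_act (a - b) w = free_act a w - free_act b w.
Proof. exact: (linear_sub a b (free_act_linear_l w)). Qed.

Lemma free_act_relator r w : env_relator h r -> free_act r w = 0.
Proof.
have [hs hB] := lsub_subalgebra h.
case=> [c x y hx hy|x y hx hy|x hx].
- apply: etrans (free_actB _ _ _) _; rewrite free_act_linear_l !free_act_gen.
  by rewrite !gen_actE //; [rewrite lact_linear_l // subrr | apply: hs.2].
- apply: etrans (free_actB _ _ _) _; apply/eqP; rewrite subr_eq0; apply/eqP.
  apply: etrans (esym (free_actB _ _ _)).
  have M2 x' y' := free_actM (free_gen F x') (free_gen F y') w.
  apply: etrans (esym (congr2 (fun u v => u - v) (M2 _ _) (M2 _ _))).
  by rewrite !free_act_gen !gen_actE //; [rewrite lact_bracket | apply: hB].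
- by rewrite free_act_gen /gen_act; case: asboolP.
Qed.

Lemma free_act_ideal z w :
  lspan (ideal_gen (env_relator h)) z -> free_act z w = 0.
Proof.
elim=> [|c _ y [a [r [b [rr ->]]]] _ IH]; first exact: free_act0.
rewrite free_act_linear_l IH addr0 free_actM free_actM (free_act_relator _ rr).
by rewrite (linear_at0 (free_act_linear_r a)) scaler0.
Qed.

Definition env_act (e : env h) (w : W) : W := free_act (qalg_repr e) w.

Lemma env_act_pi a w : env_act (qalg_pi (env_relator h) a) w = free_act a w.
Proof.
apply/eqP; rewrite -subr_eq0 -free_actB; apply/eqP/free_act_ideal.
by apply/qalg_piP; rewrite qalg_reprK.
Qed.

Lemma env_act_linear_l w : linear (env_act^~ w).
Proof.
move=> c a b; rewrite -[a]qalg_reprK -[b]qalg_reprK -linearP !env_act_pi.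
exact: free_act_linear_l.
Qed.

Lemma env_act_linear_r a : linear (env_act a).
Proof. exact: free_act_linear_r. Qed.

Lemma env_act_iota (a : env h) x w : lsub h x ->
  env_act (a * Defs.iota x : env h) w = env_act a (lact x w).
Proof.
move=> hx; rewrite -[a]qalg_reprK /Defs.iota -qalg_piMr !env_act_pi free_actM.
by rewrite free_act_gen gen_actE.
Qed.

Lemma env_act1 w : env_act 1 w = w.
Proof. by rewrite -[1]/(qalg_pi (env_relator h) 1) env_act_pi free_act1. Qed.

End EnvelopingAction.

(** The universal property of the tensor product: the map sending [a (x) v] to [a] applied to [j v]
    respects the relators, and it takes [1 (x) u] to [j u]. *)
Lemma pure1_eq0 (F : fieldType) (h p : lieSubalg F) (U : lieModule p)
    (W : lieModule h) (j : U -> W) (u : U) :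
  p `<=` h -> linear j -> (forall x v, lsub p x -> j (lact x v) = lact x (j v)) ->
  pure (1 : env h) u = 0 -> j u = 0.
Proof.
move=> ph jlin jE.
pose f : env h * U -> W := fun au => env_act au.1 (j au.2).
have fkill r : lspan (@tens_relator F h p U) r -> lext f r = 0.
  elim=> [|c x y rx _ IH]; first by rewrite linear0.
  rewrite linearP /= IH addr0; rewrite [lext f x](_ : _ = 0) ?scaler0 //.
  case: rx => [d a b v|d a v w|a z v pz]; rewrite linearB ?linearP /= !lextU /f /=.
  - by rewrite env_act_linear_l scalerN -opprD subrr.
  - by rewrite [j _]jlin env_act_linear_r scalerN -opprD subrr.
  - by rewrite jE // env_act_iota ?subrr //; apply: ph.
rewrite /pure -[RHS](linear0 (qpi _)) => /qpiP; rewrite subr0 => /fkill.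
by rewrite lextU /f /= env_act1.
Qed.

(** * A module with a prescribed top *)

Lemma sub_exchange (V : zmodType) (t x y p q : V) :
  t + (x - y) + (p - x) = t + (q - y) + (p - q).
Proof.
by rewrite -!(addrA t) (addrC (x - y)) (addrC (q - y)) !addrA !subrK.
Qed.

Section ModuleOfUnits.
Variables (F : fieldType) (X : lmodType F) (op : int -> int -> X -> X).
Hypothesis op_linear : forall m n, linear (op m n).
Hypothesis op_comm : forall m n r s x, op m n (op r s x) =
  op r s (op m n x) + ((n == r)%:R *: op m s x - (m == s)%:R *: op r n x).

Definition unit_act (g : gl F) (x : X) : X := lext (fun p => op p.1 p.2 x) g.

Lemma unit_actE m n x : unit_act (E F m n) x = op m n x.
Proof. exact: lextU. Qed.

Fact unit_act_linear_l x : linear (unit_act^~ x).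
Proof. exact: lext_is_linear. Qed.

Fact unit_act_linear_r g : linear (unit_act g).
Proof.
move=> c x y; rewrite /unit_act !lextE scaler_sumr -big_split /=.
by apply: eq_bigr => p _; rewrite op_linear scalerDr !scalerA mulrC.
Qed.

Fact unit_act_bracket g k x :
  unit_act (bracket g k) x =
  unit_act g (unit_act k x) - unit_act k (unit_act g x).
Proof.
have L := unit_act_linear_l; have R := unit_act_linear_r.
have L0 y : unit_act 0 y = 0 := linear_at0 (L y).
have R0 g' : unit_act g' 0 = 0 := linear_at0 (R g').
elim/fm_ind: g => [|c [m n] g IH]; first by rewrite bracket0l !L0 R0 subrr.
rewrite bracket_linear_l !L R IH opprD addrACA -scalerBr; congr (_ *: _ + _).
rewrite -/(E F m n) {IH g c}.
elim/fm_ind: k => [|c [r s] k IH]; first by rewrite bracket0r !L0 R0 subrr.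
rewrite bracket_linear_r !L R IH opprD addrACA -scalerBr; congr (_ *: _ + _).
rewrite -/(E F r s) bracket_E !unit_actE op_comm addrAC subrr add0r.
by rewrite (linear_sub _ _ (L x)) -!unit_actE !(linearZ_at (L x)).
Qed.

Definition unit_module : lieModule (gl_full F) :=
  @LieModule F (gl_full F) X unit_act
    (fun c g k x _ _ => unit_act_linear_l x c g k)
    (fun g _ => unit_act_linear_r g)
    (fun g k x _ _ => unit_act_bracket g k x).

End ModuleOfUnits.

(* Differential operators of order one on a cell of the Grassmannian: the unit
   [E i j] acts as [\sum_(b in S) z i b * D j b], where the coordinates [z i b]
   are [(i == b)] for [i] in [S] and the variables [y (i, b)] otherwise. *)
Section CellOperators.
Variables (F : fieldType) (X : lmodType F) (S : {fset int}).
Variables (y d : int * int -> X -> X) (T : int -> int -> X -> X).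
Hypothesis y_linear : forall e, linear (y e).
Hypothesis d_linear : forall e, linear (d e).
Hypothesis T_linear : forall j b, j \in S -> b \in S -> linear (T j b).
Hypothesis yy : forall e e' x, y e (y e' x) = y e' (y e x).
Hypothesis dd : forall e e' x, d e (d e' x) = d e' (d e x).
Hypothesis dy : forall e e' x, d e (y e' x) = y e' (d e x) + (e == e')%:R *: x.
Hypothesis Ty : forall j b r c x, j \in S -> b \in S ->
  T j b (y (r, c) x) = y (r, c) (T j b x) - (b == c)%:R *: y (r, j) x.
Hypothesis Td : forall j b s c x, j \in S -> b \in S ->
  T j b (d (s, c) x) = d (s, c) (T j b x) + (j == c)%:R *: d (s, b) x.
Hypothesis TT : forall j b s c x,
  j \in S -> b \in S -> s \in S -> c \in S ->
  T j b (T s c x) =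
  T s c (T j b x) + ((j == c)%:R *: T s b x - (b == s)%:R *: T j c x).

Definition cell_z (i b : int) (x : X) : X :=
  if i \in S then (i == b)%:R *: x else y (i, b) x.
Definition cell_D (j b : int) (x : X) : X :=
  if j \in S then T j b x else d (j, b) x.
Definition cell_op (i j : int) (x : X) : X :=
  \sum_(b <- S) cell_z i b (cell_D j b x).

Local Notation z := cell_z.
Local Notation D := cell_D.

Lemma cell_z_linear i b : linear (z i b).
Proof.
move=> c x x'; rewrite /cell_z; case: ifP => _; last exact: y_linear.
by rewrite scalerDr !scalerA mulrC.
Qed.

Lemma cell_D_linear j b : b \in S -> linear (D j b).
Proof.
move=> bS c x x'; rewrite /cell_D; case: ifP => jS; last exact: d_linear.
exact: T_linear.
Qed.

Lemma cell_zz i b r c x : z i b (z r c x) = z r c (z i b x).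
Proof.
rewrite /cell_z; case: ifP => _; case: ifP => _.
- by rewrite !scalerA mulrC.
- by rewrite (linearZ_at (y_linear _)).
- by rewrite (linearZ_at (y_linear _)).
- exact: yy.
Qed.

(** One formula for all four positions of [j] and [r]. The correction by [z r j] appears for [j] in
    [S]; when [r] is in [S] too, it cancels the first term, as it must for a constant coordinate. *)
Lemma cell_Dz j b r c x : b \in S -> c \in S ->
  D j b (z r c x) = z r c (D j b x) +
    (b == c)%:R *: ((j == r)%:R *: x - (j \in S)%:R *: z r j x).
Proof.
move=> bS cS; rewrite /cell_D /cell_z.
have neq m n : m \in S -> n \notin S -> (m == n) = false.
  by move=> mS; apply: contraNF => /eqP<-.
case: (boolP (j \in S)) => jS; case: (boolP (r \in S)) => rS.
- rewrite (linearZ_at (T_linear jS bS)) scale1r [r == j]eq_sym subrr.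
  by rewrite scaler0 addr0.
- by rewrite Ty // scale1r [j == r]neq // mulr0n scale0r sub0r scalerN.
- rewrite (linearZ_at (d_linear _)) [j == r]eq_sym [r == j]neq // !mulr0n.
  by rewrite !scale0r subrr scaler0 addr0.
- by rewrite dy xpair_eqE mulr0n scale0r subr0 scalerA -natrM mulnb andbC.
Qed.

(** Since [b] and [c] are in [S], a coefficient can be nonzero only if [j], respectively [s], is in
    [S]. This is why the relation between the operators [T] extends to all the [D]. *)
Lemma cell_DD j b s c x : b \in S -> c \in S ->
  D j b (D s c x) =
  D s c (D j b x) + ((j == c)%:R *: D s b x - (b == s)%:R *: D j c x).
Proof.
move=> bS cS; rewrite /cell_D.
have neq m n : m \in S -> n \notin S -> (m == n) = false.
  by move=> mS; apply: contraNF => /eqP<-.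
case: (boolP (j \in S)) => jS; case: (boolP (s \in S)) => sS.
- exact: TT.
- by rewrite Td // [b == s]neq // mulr0n scale0r subr0.
- rewrite Td // [j == c]eq_sym [c == j]neq // mulr0n scale0r sub0r [s == b]eq_sym.
  by rewrite addrK.
- rewrite dd [j == c]eq_sym [c == j]neq // [b == s]neq // !mulr0n.
  by rewrite !scale0r subrr addr0.
Qed.

Lemma cell_op_linear i j : linear (cell_op i j).
Proof.
move=> c x x'; rewrite /cell_op scaler_sumr -big_split /= big_seq [RHS]big_seq.
by apply: eq_bigr => b bS; rewrite cell_D_linear // cell_z_linear.
Qed.

Let A i j r s x := \sum_(b <- S) \sum_(c <- S) z i b (z r c (D j b (D s c x))).

Fact cell_op2 i j r s x : cell_op i j (cell_op r s x) =
  A i j r s x + ((j == r)%:R *: cell_op i s x -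
    (j \in S)%:R *: \sum_(b <- S) z i b (z r j (D s b x))).
Proof.
have zL := cell_z_linear.
rewrite /cell_op /A !scaler_sumr -sumrB -big_split /= big_seq [RHS]big_seq.
apply: eq_bigr => b bS.
rewrite (linear_sum_at (cell_D_linear j bS)) (linear_sum_at (zL i b)).
have -> : (j == r)%:R *: z i b (D s b x) -
    (j \in S)%:R *: z i b (z r j (D s b x)) =
    \sum_(c <- S) (c == b)%:R *:
      z i b ((j == r)%:R *: D s c x - (j \in S)%:R *: z r j (D s c x)).
  rewrite (sum_delta S (fun c => z i b ((j == r)%:R *: D s c x
    - (j \in S)%:R *: z r j (D s c x)))) bS scale1r.
  by rewrite (linear_sub _ _ (zL i b)) !(linearZ_at (zL i b)).
rewrite -big_split /= big_seq [RHS]big_seq; apply: eq_bigr => c cS.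
rewrite cell_Dz // [b == c]eq_sym (linearD_at (zL i b)).
by rewrite (linearZ_at (zL i b)).
Qed.

(** Reordering the two [D] in the second order part [A] produces terms quadratic in [z]. They cancel
    the quadratic terms of [cell_op2], which leaves only operators of order one. *)
Lemma cell_op_comm i j r s x : cell_op i j (cell_op r s x) =
  cell_op r s (cell_op i j x) +
    ((j == r)%:R *: cell_op i s x - (i == s)%:R *: cell_op r j x).
Proof.
have zL := cell_z_linear.
rewrite !cell_op2 [i == s]eq_sym.
have -> : A i j r s x = A r s i j x +
    ((j \in S)%:R *: (\sum_(b <- S) z i b (z r j (D s b x))) -
     (s \in S)%:R *: (\sum_(c <- S) z r c (z i s (D j c x)))).
  have -> : A r s i j x =
      \sum_(b <- S) \sum_(c <- S) z r c (z i b (D s c (D j b x))).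
    by rewrite /A exchange_big.
  have -> : (j \in S)%:R *: (\sum_(b <- S) z i b (z r j (D s b x))) =
      \sum_(b <- S) \sum_(c <- S) (c == j)%:R *: z i b (z r c (D s b x)).
    rewrite scaler_sumr; apply: eq_bigr => b _.
    by rewrite (sum_delta S (fun c => z i b (z r c (D s b x)))).
  have -> : (s \in S)%:R *: (\sum_(c <- S) z r c (z i s (D j c x))) =
      \sum_(b <- S) \sum_(c <- S) (b == s)%:R *: z i b (z r c (D j c x)).
    rewrite exchange_big scaler_sumr; apply: eq_bigr => c _ /=.
    rewrite (sum_delta S (fun b => z i b (z r c (D j c x)))).
    by rewrite cell_zz.
  rewrite -sumrB -big_split /= /A big_seq [RHS]big_seq; apply: eq_bigr => b bS.
  rewrite -sumrB -big_split /= big_seq [RHS]big_seq; apply: eq_bigr => c cS.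
  rewrite cell_DD // [j == c]eq_sym [z r c (z i b _)]cell_zz.
  rewrite (linearD_at (zL r c)) (linearD_at (zL i b)).
  rewrite (linear_sub _ _ (zL r c)) (linear_sub _ _ (zL i b)).
  by rewrite !(linearZ_at (zL r c)) !(linearZ_at (zL i b)).
exact: sub_exchange.
Qed.

End CellOperators.

Lemma fct_linE (F : fieldType) (T : Type) (V : lmodType F) c (f g : T -> V) t :
  (c *: f + g) t = c *: f t + g t.
Proof. by []. Qed.

Lemma fct_addE (T : Type) (V : zmodType) (f g : T -> V) t :
  (f + g) t = f t + g t.
Proof. by []. Qed.

Lemma fct_oppE (T : Type) (V : zmodType) (f : T -> V) t : (- f) t = - f t.
Proof. by []. Qed.

Lemma fct_scaleE (F : fieldType) (T : Type) (V : lmodType F) c (f : T -> V) t :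
  (c *: f) t = c *: f t.
Proof. by []. Qed.

Definition fct_opE := (fct_addE, fct_oppE, fct_scaleE).

Lemma sub_regroup (V : zmodType) (a x z r : V) :
  a - x - (z - r) = a + r - (x + z).
Proof. by rewrite opprB opprD -!addrA (addrCA (- x) r). Qed.

Lemma sub_combine (V : zmodType) (l r x x' p p' q q' : V) :
  l + (p - q) + (r + (q' - p')) - (x + x') =
  l + r - (x' + x) + (p - p' - (q - q')).
Proof.
rewrite addrACA -(addrAC (l + r)) [x + x']addrC; congr (_ + _).
by rewrite opprB [q' - p']addrC [q' - q]addrC addrACA.
Qed.

(** * Power series in divided powers with coefficients in [U] *)

Section CellModule.
Variables (F : fieldType) (S : {fset int}) (U : lieModule (gl_sub F S)).
Local Notation index := {mset int * int}%mset.
Local Notation X := (index -> U).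

(* The function [f] stands for the linear form [x^m |-> f m] on polynomials,
   [cell_y e] for the transpose of [d/dx_e], and [cell_d e] for that of the
   multiplication by [x_e]. *)
Definition cell_y (e : int * int) (f : X) : X :=
  fun m => (m e)%:R *: f (m `\ e)%mset.
Definition cell_d (e : int * int) (f : X) : X := fun m => f (e +` m)%mset.

Definition cell_q (j b k : int) (f : X) : X := cell_y (k, j) (cell_d (k, b) f).

Definition mrows (m : index) : {fset int} :=
  [fset e.1 | e in (finsupp m : {fset int * int})]%fset.

(* [\sum_k y (k, j) * d/dy (k, b)]: the sum is finite at every index. *)
Definition cell_r (j b : int) (f : X) : X :=
  fun m => \sum_(k <- mrows m) cell_q j b k f m.

(** Origin: for functions of all coordinates [z k b] that are equivariant under right multiplication
    by [gl_S], the sum over [k] of [z k j * d/dz (k, b)] equals [E b j]. On the cell the rows in [S]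
    form the identity matrix, and solving for [d/dz (j, b)] gives this formula. *)
Definition cell_t (j b : int) (f : X) : X :=
  fun m => lact (E F b j) (f m) - cell_r j b f m.

Lemma cell_y_linear e : linear (cell_y e).
Proof.
move=> c f g; apply/funext => m; rewrite /cell_y !fct_linE.
by rewrite scalerDr !scalerA mulrC.
Qed.

Lemma cell_d_linear e : linear (cell_d e).
Proof. by move=> c f g; apply/funext. Qed.

Lemma cell_q_linear j b k : linear (cell_q j b k).
Proof. by move=> c f g; rewrite /cell_q cell_d_linear cell_y_linear. Qed.

Lemma cell_r_linear j b : linear (cell_r j b).
Proof.
move=> c f g; apply/funext => m; rewrite fct_linE /cell_r.
rewrite scaler_sumr -big_split /=; apply: eq_bigr => k _.
by rewrite cell_q_linear fct_linE.
Qed.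

Lemma cell_t_linear j b : j \in S -> b \in S -> linear (cell_t j b).
Proof.
move=> jS bS c f g; apply/funext => m.
rewrite fct_linE /cell_t cell_r_linear !fct_linE.
have hE : lsub (gl_sub F S) (E F b j) by apply: (index_E (@gl_sub_spanned F S)).
by rewrite lact_linear_r // opprD addrACA -scalerBr.
Qed.

Lemma cell_yy e e' f : cell_y e (cell_y e' f) = cell_y e' (cell_y e f).
Proof.
apply/funext => m; rewrite /cell_y !scalerA -!natrM !msetB1E.
have -> : (m `\ e `\ e' = m `\ e' `\ e)%mset.
  by apply/msetP => k; rewrite !msetB1E subnAC.
congr (_%:R *: _); by case: (eqVneq e e') => [->//|_]; rewrite !subn0 mulnC.
Qed.

Lemma cell_dd e e' f : cell_d e (cell_d e' f) = cell_d e' (cell_d e f).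
Proof. by apply/funext => m; rewrite /cell_d msetDCA. Qed.

Lemma cell_dy e e' f :
  cell_d e (cell_y e' f) = cell_y e' (cell_d e f) + (e == e')%:R *: f.
Proof.
apply/funext => m; rewrite !fct_opE /cell_d /cell_y.
rewrite mset1DE; case: (eqVneq e e') => [<-|ne] /=.
  rewrite add1n -addn1 natrD scalerDl msetD1K; congr (_ + _).
  case: (posnP (m e)) => [->|me]; first by rewrite !scale0r.
  by rewrite msetB1K // -mset_gt0.
rewrite add0n [X in _ = _ + X]scale0r addr0.
case: (posnP (m e')) => [->|me']; first by rewrite !scale0r.
congr (_ *: f _); apply/msetP => k; rewrite !mset1DE !msetB1E mset1DE.
case: (eqVneq k e) => [->|//]; first by rewrite (negbTE ne) !subn0.
Qed.

Lemma mrowsP (m : index) e : e \in m -> e.1 \in mrows m.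
Proof. by move=> em; apply/imfsetP; exists e => //=; rewrite msuppE. Qed.

Lemma mrows_in (m : index) k : k \in mrows m -> exists2 e, e \in m & k = e.1.
Proof. by case/imfsetP => e /= em ->; exists e => //; rewrite -msuppE. Qed.

Definition rows_in (A : {fset int}) (m : index) := (mrows m `<=` A)%fset.

Lemma rows_inP A (m : index) : (forall e, e \in m -> e.1 \in A) -> rows_in A m.
Proof. by move=> mA; apply/fsubsetP => k /mrows_in [e em ->]; apply: mA. Qed.

Lemma rows_inE A (m : index) e : rows_in A m -> e \in m -> e.1 \in A.
Proof. by move=> /fsubsetP mA em; apply/mA/mrowsP. Qed.

Lemma rows_inB A (m : index) e : rows_in A m -> rows_in A (m `\ e)%mset.
Proof.
move=> mA; apply: rows_inP => e'; rewrite in_msetB1 => /andP[_].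
exact: rows_inE.
Qed.

Lemma rows_inD A (m : index) e :
  e.1 \in A -> rows_in A m -> rows_in A (e +` m)%mset.
Proof.
move=> eA mA; apply: rows_inP => e'; rewrite in_mset1D => /orP[/eqP->//|].
exact: rows_inE.
Qed.

(** The range of the sum in [cell_r] depends on the index, which the other operators change. Over a
    fixed set of rows containing all those involved, the sum is an honest finite sum of
    operators. *)
Definition cell_rA (A : {fset int}) (j b : int) (f : X) : X :=
  fun m => \sum_(k <- A) cell_q j b k f m.

Lemma cell_rE A j b f m : rows_in A m -> cell_r j b f m = cell_rA A j b f m.
Proof.
move=> mA; apply: big_fset_incl => // k _ km; rewrite /cell_q /cell_y.
suff -> : m (k, j) = 0%N by rewrite scale0r.
by apply/eqP; rewrite mset_eq0; apply: contra km => /mrowsP.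
Qed.

Lemma cell_rA_apply A j b f :
  cell_rA A j b f = \sum_(k <- A) cell_q j b k f.
Proof. by apply/funext => m; rewrite fct_sumE. Qed.

Lemma cell_q_local A j b k f g m : k \in A -> rows_in A m ->
  (forall m', rows_in A m' -> f m' = g m') -> cell_q j b k f m = cell_q j b k g m.
Proof.
move=> kA mA fg; rewrite /cell_q /cell_y /cell_d fg //.
by apply: rows_inD => //; apply: rows_inB.
Qed.

Lemma cell_qy j b k e f : cell_q j b k (cell_y e f) =
  cell_y e (cell_q j b k f) + ((k, b) == e)%:R *: cell_y (k, j) f.
Proof.
rewrite /cell_q cell_dy (linearD_at (cell_y_linear _)) cell_yy.
by rewrite (linearZ_at (cell_y_linear _)).
Qed.

Lemma cell_dq j b k e f : cell_d e (cell_q j b k f) =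
  cell_q j b k (cell_d e f) + (e == (k, j))%:R *: cell_d (k, b) f.
Proof. by rewrite /cell_q cell_dy cell_dd. Qed.

Lemma cell_qq j b k s c l f : cell_q j b k (cell_q s c l f) =
  cell_q s c l (cell_q j b k f) + ((k, b) == (l, s))%:R *: cell_q j c k f
    - ((l, c) == (k, j))%:R *: cell_q s b k f.
Proof.
rewrite [cell_q s c l f]/cell_q cell_qy.
have -> : cell_q j b k (cell_d (l, c) f) = cell_d (l, c) (cell_q j b k f)
   - ((l, c) == (k, j))%:R *: cell_d (k, b) f by rewrite cell_dq addrK.
rewrite (linear_sub _ _ (cell_y_linear _)) (linearZ_at (cell_y_linear _)).
rewrite [in RHS]addrAC; congr (_ + _).
  by congr (_ - _); case: eqP => [[-> _]|_]; rewrite ?mulr0n ?scale0r.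
by case: eqP => [[-> _]|_]; rewrite ?mulr0n ?scale0r.
Qed.

Lemma sum_pair_delta (V : lmodType F) (A : {fset int}) (g : int -> V)
    (r : int) (p q : int) : r \in A ->
  \sum_(k <- A) ((k, p) == (r, q))%:R *: g k = (p == q)%:R *: g r.
Proof.
move=> rA; have := sum_delta A (fun k => (p == q)%:R *: g k) r.
rewrite rA scale1r => <-; apply: eq_bigr => k _.
by rewrite xpair_eqE scalerA -natrM mulnb.
Qed.

Lemma cell_ry j b r c f : cell_r j b (cell_y (r, c) f) =
  cell_y (r, c) (cell_r j b f) + (b == c)%:R *: cell_y (r, j) f.
Proof.
(* The row [r] is added because the commutator comes entirely from the term [k = r]. *)
apply/funext => m; pose A := (r |` mrows m)%fset.
have mA : rows_in A m by apply: fsubsetUr.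
have rA : r \in A by rewrite !inE eqxx.
rewrite !fct_opE (cell_rE _ _ _ mA) /cell_rA.
have -> : cell_y (r, c) (cell_r j b f) m = cell_y (r, c) (cell_rA A j b f) m.
  by rewrite /cell_y (@cell_rE A) //; apply: rows_inB.
rewrite -(sum_pair_delta (fun k => cell_y (k, j) f m) b c rA).
have -> : cell_y (r, c) (cell_rA A j b f) m =
    \sum_(k <- A) cell_y (r, c) (cell_q j b k f) m.
  by rewrite /cell_y /cell_rA scaler_sumr.
by rewrite -big_split; apply: eq_bigr => k _; rewrite cell_qy.
Qed.

Lemma cell_dr j b s c f : cell_d (s, c) (cell_r j b f) =
  cell_r j b (cell_d (s, c) f) + (j == c)%:R *: cell_d (s, b) f.
Proof.
apply/funext => m; pose A := (s |` mrows m)%fset.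
have mA : rows_in A m by apply: fsubsetUr.
have sA : s \in A by rewrite !inE eqxx.
rewrite !fct_opE (cell_rE _ _ _ mA) /cell_rA.
have -> : cell_d (s, c) (cell_r j b f) m = cell_d (s, c) (cell_rA A j b f) m.
  by rewrite /cell_d (@cell_rE A) //; apply: rows_inD.
rewrite -(sum_pair_delta (fun k => cell_d (k, b) f m) j c sA) -big_split.
apply: eq_bigr => k _ /=; rewrite [(k, j) == _]eq_sym.
by rewrite -[LHS]/(cell_d (s, c) (cell_q j b k f) m) cell_dq.
Qed.

Lemma cell_rr j b s c f : cell_r j b (cell_r s c f) =
  cell_r s c (cell_r j b f) +
    ((b == s)%:R *: cell_r j c f - (j == c)%:R *: cell_r s b f).
Proof.
apply/funext => m; pose A := mrows m.
have mA : rows_in A m by apply: fsubset_refl.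
have rrE j' b' s' c' : cell_r j' b' (cell_r s' c' f) m =
    \sum_(k <- A) \sum_(l <- A) cell_q j' b' k (cell_q s' c' l f) m.
  rewrite /cell_r -/A big_seq [RHS]big_seq; apply: eq_bigr => k kA.
  rewrite (@cell_q_local A _ _ _ _ (cell_rA A s' c' f)) //; last first.
    by move=> m' m'A; rewrite -(@cell_rE A).
  rewrite cell_rA_apply.
  by rewrite (linear_sum_at (cell_q_linear _ _ _)) fct_sumE.
rewrite !fct_opE !rrE [in RHS]exchange_big /=.
rewrite /cell_r -/A !scaler_sumr -sumrB -big_split /= big_seq [RHS]big_seq.
apply: eq_bigr => k kA.
have -> : (b == s)%:R *: cell_q j c k f m =
    \sum_(l <- A) ((l, s) == (k, b))%:R *: cell_q j c k f m.
  by rewrite (sum_pair_delta (fun=> cell_q j c k f m)) // eq_sym.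
have -> : (j == c)%:R *: cell_q s b k f m =
    \sum_(l <- A) ((l, c) == (k, j))%:R *: cell_q s b k f m.
  by rewrite (sum_pair_delta (fun=> cell_q s b k f m)) // eq_sym.
rewrite -sumrB -big_split; apply: eq_bigr => l _ /=.
by rewrite cell_qq [(l, s) == _]eq_sym addrA.
Qed.

Lemma cell_r_lact x j b f : lsub (gl_sub F S) x ->
  cell_r j b (fun m => lact x (f m)) = (fun m => lact x (cell_r j b f m)).
Proof.
move=> hx; apply/funext => m; rewrite /cell_r lact_sum //.
by apply: eq_bigr => k _; rewrite /cell_q /cell_y lactZ.
Qed.

Lemma cell_ty j b r c f : j \in S -> b \in S ->
  cell_t j b (cell_y (r, c) f) =
  cell_y (r, c) (cell_t j b f) - (b == c)%:R *: cell_y (r, j) f.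
Proof.
move=> jS bS; apply/funext => m.
have hE : lsub (gl_sub F S) (E F b j) by apply: (index_E (@gl_sub_spanned F S)).
rewrite !fct_opE /cell_t cell_ry !fct_opE.
by rewrite opprD addrA; congr (_ - _); rewrite /cell_y lactZ // -scalerBr.
Qed.

Lemma cell_td j b s c f : j \in S -> b \in S ->
  cell_t j b (cell_d (s, c) f) =
  cell_d (s, c) (cell_t j b f) + (j == c)%:R *: cell_d (s, b) f.
Proof.
move=> jS bS; apply/funext => m.
rewrite !fct_opE {1}/cell_t.
have -> : cell_d (s, c) (cell_t j b f) m =
    lact (E F b j) (cell_d (s, c) f m) - cell_d (s, c) (cell_r j b f) m by [].
by rewrite cell_dr !fct_opE opprD addrA subrK.
Qed.

(** The action of [E b j] on the values and the operator [- cell_r j b] satisfy the same commutation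
    relations and commute with each other, so their sum satisfies these relations as well. *)
Lemma cell_tt j b s c f : j \in S -> b \in S -> s \in S -> c \in S ->
  cell_t j b (cell_t s c f) = cell_t s c (cell_t j b f) +
    ((j == c)%:R *: cell_t s b f - (b == s)%:R *: cell_t j c f).
Proof.
move=> jS bS sS cS; apply/funext => m; have subP := @gl_sub_spanned F S.
have hE p q : p \in S -> q \in S -> lsub (gl_sub F S) (E F p q).
  by move=> pS qS; apply: (index_E subP).
rewrite !fct_opE.
have ttE j' b' s' c' : j' \in S -> b' \in S -> s' \in S -> c' \in S ->
    cell_t j' b' (cell_t s' c' f) m =
    lact (E F b' j') (lact (E F c' s') (f m)) + cell_r j' b' (cell_r s' c' f) m
    - (lact (E F b' j') (cell_r s' c' f m) + lact (E F c' s') (cell_r j' b' f m)).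
  move=> jS' bS' sS' cS'; rewrite {1}/cell_t.
  have -> : cell_t s' c' f =
      (fun m => lact (E F c' s') (f m)) - cell_r s' c' f by [].
  rewrite (linear_sub _ _ (cell_r_linear _ _)) cell_r_lact; last exact: hE.
  rewrite !fct_opE.
  rewrite lactB; last exact: hE.
  exact: sub_regroup.
rewrite !ttE // cell_rr !fct_opE.
by rewrite (lact_E subP) // !scalerBr sub_combine.
Qed.

Definition cell_module : lieModule (gl_full F) :=
  unit_module
    (cell_op_linear cell_y_linear cell_d_linear cell_t_linear)
    (cell_op_comm cell_y_linear cell_d_linear cell_t_linear
       cell_yy cell_dd cell_dy cell_ty cell_td cell_tt).

Definition cell_const (u : U) : cell_module :=
  fun m : index => if m == mset0 then u else 0.

Fact cell_const0 e m u : cell_const u (e +` m)%mset = 0.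
Proof.
rewrite /cell_const ifF //; apply/eqP => /msetP /(_ e).
by rewrite mset1DE eqxx mset0E.
Qed.

Lemma cell_const_hw : hw_map predT cell_const.
Proof.
have actE m n f : lact (E F m n) (f : cell_module) =
    cell_op S cell_y cell_d cell_t m n f by exact: unit_actE.
have zL := cell_z_linear S cell_y_linear.
have d0 e u : cell_d e (cell_const u) = 0.
  by apply/funext => m; rewrite /cell_d cell_const0.
have r0 j b u : cell_r j b (cell_const u) = 0.
  apply/funext => m; rewrite /cell_r big1 // => k _.
  by rewrite /cell_q d0 (linear_at0 (cell_y_linear _)).
split=> [c u v|m n u mS nS|m n u _ _ nS].
- apply/funext => m; rewrite fct_linE /cell_const; case: ifP => // _.
  by rewrite scaler0 addr0.
- rewrite actE /cell_op /cell_z mS.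
  pose D b := cell_D S cell_d cell_t n b (cell_const u).
  rewrite (_ : \sum_(b <- S) _ = \sum_(b <- S) (b == m)%:R *: D b); last first.
    by apply: eq_bigr => b _; rewrite eq_sym.
  rewrite sum_delta mS scale1r /D /cell_D nS; apply/funext => i; rewrite /cell_t r0 subr0.
  rewrite /cell_const; case: ifP => // _; rewrite lact0 //.
  by apply: (index_E (@gl_sub_spanned F S)).
- rewrite actE /cell_op big1 // => b _.
  by rewrite /cell_D (negbTE nS) d0 (linear_at0 (zL _ _)).
Qed.

Lemma cell_const_injective u : cell_const u = 0 -> u = 0.
Proof.
move/(congr1 (fun f : index -> U => f mset0)).
by rewrite /cell_const eqxx.
Qed.

End CellModule.

(** * The scalar action of I_S *)

(** Stated for countable unions of finite lists because Dixmier's argument sorts the scalars [c] by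
    the number of basis vectors that the resolvent vector at [c] involves. *)
Definition uncountable (T : choiceType) : Prop :=
  forall s : nat -> seq T, exists x, forall n, x \notin s n.

Section RealUncountable.
Variable R : realType.

Fact avoid_seq (l : seq R) (a b : R) : a < b ->
  exists a' b' : R, [/\ a <= a', a' < b', b' <= b
    & forall x, a' <= x <= b' -> x \notin l].
Proof.
elim: l a b => [|y l IH] a b ab; first by exists a, b.
pose c := (a + b) / 2.
have ac : a < c by rewrite /c midf_lt.
have cb : c < b by rewrite /c midf_lt.
have [yc|cy] := leP y c.
  (* The right half is shrunk once more, since [y] may be its left end [c]. *)
  have cd : (c + b) / 2 < b by rewrite midf_lt.
  have [a' [b' [aa' ab' bb' avoid]]] := IH _ _ cd.
  exists a', b'; split=> // [|x /andP[ax xb]].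
    by apply: le_trans aa'; apply: ltW; apply: lt_trans ac _; rewrite midf_lt.
  rewrite inE negb_or avoid ?ax // andbT; apply/eqP => xy.
  have : c < x by apply: lt_le_trans (le_trans aa' ax); rewrite midf_lt.
  by rewrite xy ltNge yc.
have [a' [b' [aa' ab' bb' avoid]]] := IH _ _ ac.
exists a', b'; split=> // [|x /andP[ax xb]].
  by apply: le_trans bb' _; apply: ltW.
rewrite inE negb_or avoid ?ax // andbT; apply/eqP => xy.
by move: cy; rewrite -xy ltNge (le_trans xb bb').
Qed.

(** Cantor's nested intervals: the [n.+1]-st interval avoids [s n], and the supremum of the left
    ends lies in all of them. *)
Lemma real_uncountable : uncountable R.
Proof.
move=> s; pose good (l : seq R) (p q : R * R) := p.1 < p.2 -> [/\ p.1 <= q.1,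
  q.1 < q.2, q.2 <= p.2 & forall x, q.1 <= x <= q.2 -> x \notin l].
have ex l p : exists q, good l p q.
  have [p12|p12] := pselect (p.1 < p.2); last by exists p => /p12.
  by have [a' [b' [? ? ? ?]]] := avoid_seq l p12; exists (a', b').
have /choice [f fP] : forall lp : seq R * (R * R), exists q, good lp.1 lp.2 q.
  by move=> lp; apply: ex.
pose I := fix I n : R * R := if n is k.+1 then f (s k, I k) else (0, 1).
have Ilt n : (I n).1 < (I n).2.
  elim: n => [|n IH] /=; first exact: ltr01.
  by case: (fP (s n, I n) IH).
have Istep n : [/\ (I n).1 <= (I n.+1).1, (I n.+1).2 <= (I n).2
    & forall x, (I n.+1).1 <= x <= (I n.+1).2 -> x \notin s n].
  by case: (fP (s n, I n) (Ilt n)) => *; split.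
have Ile1 n k : (I n).1 <= (I (n + k)%N).1.
  elim: k => [|k IH]; first by rewrite addn0.
  by rewrite addnS; have [h _ _] := Istep (n + k)%N; apply: le_trans IH h.
have Ile2 n k : (I (n + k)%N).2 <= (I n).2.
  elim: k => [|k IH]; first by rewrite addn0.
  by rewrite addnS; have [_ h _] := Istep (n + k)%N; apply: le_trans h IH.
have I12 n k : (I n).1 <= (I k).2.
  apply: le_trans (Ile1 n k) _; apply: le_trans (ltW (Ilt _)) _.
  by rewrite addnC; apply: Ile2.
pose A : set R := range (fun n => (I n).1).
have Aub k : ubound A (I k).2 by move=> _ [n _ <-]; apply: I12.
have A0 : A !=set0 by exists (I 0%N).1, 0%N.
exists (sup A) => n; have [_ _ h] := Istep n; apply: h; apply/andP; split.
  by apply: ub_le_sup; [exists (I 0%N).2; apply: Aub | exists n.+1].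
by apply: ge_sup => //; apply: Aub.
Qed.

Lemma complex_uncountable : uncountable R[i].
Proof.
move=> s; have [x xs] := real_uncountable (fun n => map (@complex.Re R) (s n)).
exists (x%:C)%C => n; apply: contra (xs n) => xn.
by apply/mapP; exists (x%:C)%C.
Qed.

End RealUncountable.

(** * Polynomials in an operator without eigenvectors *)

Section PolynomialAction.
Variables (F : fieldType) (V : lmodType F) (T : V -> V).
Hypothesis Tlin : linear T.

Definition poly_act (p : {poly F}) (v : V) : V :=
  \sum_(i < size p) p`_i *: iter i T v.

Lemma poly_actE n (p : {poly F}) v : (size p <= n)%N ->
  poly_act p v = \sum_(i < n) p`_i *: iter i T v.
Proof.
move=> pn; rewrite /poly_act (big_ord_widen n (fun i => p`_i *: iter i T v) pn).
rewrite big_mkcond; apply: eq_bigr => i _; case: ltnP => // /(nth_default 0)->.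
by rewrite scale0r.
Qed.

Lemma poly_act_linear_l v : linear (poly_act^~ v).
Proof.
move=> c p q; pose n := maxn (size (c *: p + q)) (maxn (size p) (size q)).
rewrite !(@poly_actE n) ?leq_max ?leqnn ?orbT // scaler_sumr -big_split /=.
by apply: eq_bigr => i _; rewrite coefD coefZ scalerDl scalerA.
Qed.

Lemma poly_act_linear_r p : linear (poly_act p).
Proof.
move=> c v w; rewrite /poly_act scaler_sumr -big_split /=; apply: eq_bigr => i _.
have -> : iter i T (c *: v + w) = c *: iter i T v + iter i T w.
  by elim: (nat_of_ord i) => [//|k IH] /=; rewrite IH Tlin.
by rewrite scalerDr !scalerA mulrC.
Qed.

Lemma poly_actT p v : poly_act p (T v) = T (poly_act p v).
Proof.
rewrite /poly_act (linear_sum_at Tlin); apply: eq_bigr => i _.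
by rewrite (linearZ_at Tlin) -iterSr.
Qed.

Lemma poly_act_factor a p v :
  poly_act (('X - a%:P) * p) v = poly_act p (T v - a *: v).
Proof.
have -> : ('X - a%:P) * p = (- a) *: p + p * 'X.
  by rewrite mulrBl mul_polyC commr_polyX scaleNr addrC.
rewrite poly_act_linear_l (linear_sub _ _ (poly_act_linear_r p)).
rewrite (linearZ_at (poly_act_linear_r p)) scaleNr addrC; congr (_ - _).
rewrite poly_actT (@poly_actE (size p).+1); last first.
  by apply: leq_trans (size_polyMleq _ _) _; rewrite size_polyX addn2.
rewrite big_ord_recl coefMX eqxx scale0r add0r /poly_act.
have -> : T (\sum_(i < size p) p`_i *: iter i T v) =
    \sum_(i < size p) p`_i *: iter i.+1 T v.
  rewrite (linear_sum_at Tlin); apply: eq_bigr => i _.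
  by rewrite (linearZ_at Tlin).
by apply: eq_bigr => i _; rewrite coefMX.
Qed.

Lemma poly_act_prod (r : seq F) v :
  (forall a w, T w = a *: w -> w = 0) ->
  poly_act (\prod_(a <- r) ('X - a%:P)) v = 0 -> v = 0.
Proof.
move=> Teig; elim: r v => [|a r IH] v.
  rewrite big_nil /poly_act size_poly1 big_ord1 coef1 scale1r; exact.
rewrite big_cons poly_act_factor => /IH /eqP; rewrite subr_eq0 => /eqP; exact: Teig.
Qed.

End PolynomialAction.

(** Applying the product of all [T - a j] to a relation gives [p(T) u = 0], where [p] is the sum of
    the [x i * Q i]. Evaluation at [a i] leaves only the [i]-th term, so [p] is nonzero if [x i] is;
    but [p] splits into linear factors, each acting injectively. *)
Lemma resolvent_independent (F : closedFieldType) (V : lmodType F) (T : V -> V)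
    (u : V) (w : F -> V) n (a x : 'I_n -> F) :
  linear T -> (forall c v, T v = c *: v -> v = 0) -> u <> 0 ->
  (forall c, T (w c) - c *: w c = u) -> injective a ->
  \sum_(i < n) x i *: w (a i) = 0 -> forall i, x i = 0.
Proof.
move=> Tlin Teig u0 wE ainj xw i; apply/eqP; apply/negPn/negP => xi.
pose Q i := \prod_(j < n | j != i) ('X - (a j)%:P).
pose p := \sum_(i < n) x i *: Q i.
have pu : poly_act T p u = 0.
  rewrite /p (linear_sum_at (poly_act_linear_l T u)).
  have rL := poly_act_linear_r Tlin (\prod_(j < n) ('X - (a j)%:P)).
  apply: etrans (etrans (congr1 _ xw) (linear_at0 rL)).
  rewrite (linear_sum_at rL); apply: eq_bigr => k _.
  rewrite (linearZ_at rL) (linearZ_at (poly_act_linear_l T u)); congr (_ *: _).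
  by rewrite (bigD1 k) //= poly_act_factor // wE.
have p0 : p != 0.
  apply/eqP => /(congr1 (fun q => q.[a i])); rewrite horner0 horner_sum.
  rewrite (bigD1 i) //= big1 ?addr0 => [|k ki].
    rewrite hornerZ horner_prod => /eqP; rewrite mulf_eq0 (negbTE xi) /=.
    rewrite prodf_seq_eq0 => /hasP [j _ /andP[ji]].
    rewrite hornerXsubC subr_eq0 => /eqP /ainj ij.
    by rewrite ij eqxx in ji.
  rewrite hornerZ horner_prod (bigD1 i) 1?eq_sym //= hornerXsubC subrr.
  by rewrite mul0r mulr0.
have [r pE] := closed_field_poly_normal p.
apply: u0; apply: (poly_act_prod Tlin (r := r) Teig).
move: pu; rewrite pE (linearZ_at (poly_act_linear_l T u)) => /eqP.
by rewrite scaler_eq0 lead_coef_eq0 (negbTE p0) => /eqP.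
Qed.

Lemma uniq_seq_or_cover (T : choiceType) (A : set T) n :
  (exists s : seq T, [/\ uniq s, size s = n & forall x, x \in s -> A x]) \/
  (exists s : seq T, forall x, A x -> x \in s).
Proof.
elim: n => [|n [[s [us sn sA]]|]]; [by left; exists [::] | | by right].
have [[x [Ax xs]]|no] := pselect (exists x, A x /\ x \notin s).
  left; exists (x :: s); split=> /= [||y]; rewrite ?xs ?sn //.
  by rewrite inE => /orP[/eqP->//|/sA].
right; exists s => x Ax; apply/negPn/negP => xs; by case: no; exists x.
Qed.

Lemma left_kernel_vector (F : fieldType) n (M : 'M[F]_(n.+1, n)) :
  exists2 x : 'rV[F]_n.+1, x != 0 & x *m M = 0.
Proof.
have : kermx M != 0.
  rewrite -mxrank_eq0 mxrank_ker -lt0n subn_gt0.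
  exact: leq_ltn_trans (rank_leq_col M) _.
by move=> /rowV0Pn[x /sub_kermxP xM x0]; exists x.
Qed.

(* Dixmier's form of Schur's lemma: otherwise the resolvent vectors
   [(T - a)^-1 u] of [T = euler S] would be uncountably many linearly
   independent vectors of a module of countable dimension. *)
Lemma irreducible_euler_scalar (F : closedFieldType) (S : {fset int})
    (U : lieModule (gl_sub F S)) :
  uncountable F -> irreducible U -> exists a, euler_scalar U a.
Proof.
move=> uncF [[u u0] irrU]; have subP := @gl_sub_spanned F S.
have SS : {subset S <= mem S} by [].
have hE m n : m \in S -> n \in S -> lsub (gl_sub F S) (E F m n).
  by move=> mS nS; apply: (index_E subP).
pose T := @euler F (gl_sub F S) S U.
have Tlin : linear T := euler_linear subP SS (V := U).
have TE m n v : m \in S -> n \in S ->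
    T (lact (E F m n) v) = lact (E F m n) (T v).
  by move=> mS nS; rewrite /T (euler_E subP SS) // mS nS subrr scale0r addr0.
apply: contrapT => nscal.
(* As [T] commutes with [gl_S], the kernel and the image of [T - c] are submodules. Since [T] is not
   scalar, irreducibility makes every [T - c] bijective, as shown here and in [Tsurj]. *)
have Teig c v : T v = c *: v -> v = 0.
  have Ksub : is_submodule [set v : U | T v = c *: v].
    apply: (submodule_units subP).
      split=> [|d v1 v2 /= T1 T2]; first by rewrite /= (linear_at0 Tlin) scaler0.
      by rewrite Tlin T1 T2 scalerDr !scalerA mulrC.
    by move=> m n v1 mS nS /= T1; rewrite TE // T1 lactZ //; apply: hE.
  have [K0|KT] := irrU _ Ksub => Tv.
    by have : [set v : U | T v = c *: v] v by []; rewrite K0.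
  case: nscal; exists c => v1.
  by have : setT v1 by []; rewrite -KT.
have Tsurj c v : exists w, T w - c *: w = v.
  have Isub : is_submodule [set v : U | exists w, T w - c *: w = v].
    apply: (submodule_units subP).
      split=> [|d v1 v2 /= [w1 <-] [w2 <-]].
        by exists 0; rewrite (linear_at0 Tlin) scaler0 subrr.
      exists (d *: w1 + w2).
      by rewrite Tlin scalerDr scalerBr opprD addrACA !scalerA mulrC.
    move=> m n v1 mS nS /= [w <-]; exists (lact (E F m n) w).
    by rewrite TE // lactB ?lactZ //; apply: hE.
  have [I0|IT] := irrU _ Isub; last by have : setT v by []; rewrite -IT.
  case: u0; apply: (Teig c); apply/eqP; rewrite -subr_eq0; apply/eqP.
  have : [set v : U | exists w, T w - c *: w = v] (T u - c *: u) by exists u.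
  by rewrite I0.
pose act (p : int * int) (v : U) : U :=
  if (p.1 \in S) && (p.2 \in S) then lact (E F p.1 p.2) v else 0.
(* An enumeration of the vectors obtained from [u] by words in the units, which span [U]; numbers
   that code no word give 0. *)
pose B (n : nat) : U :=
  if choice.unpickle n is Some wd then foldr act u (wd : seq (int * int)) else 0.
pose G : set U :=
  [set v | exists n (c : nat -> F), v = \sum_(k < n) c k *: B k].
have GB n : G (B n).
  exists n.+1, (fun k => (k == n)%:R); rewrite big_ord_recr /= eqxx scale1r.
  by rewrite big1 ?add0r // => i _; rewrite ltn_eqF // scale0r.
have GE : G = family_sum (fun k => [set v | exists c, v = c *: B k]).
  apply/seteqP; split=> [v [n [c ->]]|v [n [vs [vsP ->]]]].
    by exists n, (fun k => c k *: B k); split=> // k; exists (c k).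
  have /choice [c cP] := vsP; exists n, c; apply: eq_bigr => k _; exact: cP.
have Gs : is_subspace G.
  rewrite GE; apply: family_sum_subspace => k; split.
    by exists 0; rewrite scale0r.
  move=> d v w [c1 ->] [c2 ->]; exists (d * c1 + c2).
  by rewrite scalerDl scalerA.
have GT : G = setT.
  have Gsub : is_submodule G.
    apply: (submodule_units subP Gs) => m n v mS nS [q [c ->]].
    rewrite lact_sum; last exact: hE.
    apply: (subspace_sum Gs) => k _; rewrite lactZ; last exact: hE.
    apply: (subspaceZ Gs); rewrite {1}/B.
    case kE: (choice.unpickle k) => [wd|]; last first.
      by rewrite lact0; [apply: (subspace0 Gs) | apply: hE].
    suff -> : lact (E F m n) (foldr act u wd) = B (choice.pickle ((m, n) :: wd)).
      exact: GB.
    by rewrite /B choice.pickleK /= /act /= [m \in S]mS [n \in S]nS.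
  have [G0|//] := irrU _ Gsub; case: u0.
  have := GB (choice.pickle ([::] : seq (int * int))).
  by rewrite G0 /B choice.pickleK.
have /choice [w wE] c : exists w, T w - c *: w = u by apply: Tsurj.
have /choice [nc ncE] c : exists nc : nat * (nat -> F),
    w c = \sum_(k < nc.1) nc.2 k *: B k.
  by have : setT (w c) by []; rewrite -GT => -[n [d wcE]]; exists (n, d).
(* If each [n] were the length for at most [n] scalars [c], then finite lists indexed by [n] would
   cover the field. *)
have [n [s [us sn sA]]] : exists n (s : seq F),
    [/\ uniq s, size s = n.+1 & forall c, c \in s -> (nc c).1 = n].
  apply: contrapT => none.
  have /choice [s sP] n : exists s : seq F, forall c, (nc c).1 = n -> c \in s.
    have [[s sP]|//] := uniq_seq_or_cover [set c | (nc c).1 = n] n.+1.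
    by case: none; exists n, s.
  by have [c /(_ (nc c).1)] := uncF s; rewrite sP.
pose a (i : 'I_n.+1) := s`_i.
have as_ i : a i \in s by rewrite mem_nth // sn.
(* There are [n.+1] resolvent vectors in the span of [n] vectors, hence a linear relation between
   them. *)
have [x x0 xM] := left_kernel_vector (\matrix_(i < n.+1, k < n) (nc (a i)).2 k).
case/eqP: x0; apply/rowP => i; rewrite mxE.
apply: (@resolvent_independent _ U T u w n.+1 a (x 0)) => //.
  move=> i1 i2 /eqP; rewrite /a nth_uniq ?sn // => /eqP; exact: val_inj.
set M := \matrix_(i, k) _ in xM.
transitivity (\sum_(k < n) (x *m M) 0 k *: B k).
  have -> : \sum_(j < n.+1) x 0 j *: w (a j) =
      \sum_(j < n.+1) \sum_(k < n) (x 0 j * (nc (a j)).2 k) *: B k.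
    apply: eq_bigr => j _; rewrite ncE (sA _ (as_ j)) scaler_sumr.
    by apply: eq_bigr => k _; rewrite scalerA.
  rewrite exchange_big; apply: eq_bigr => k _; rewrite mxE scaler_suml.
  by apply: eq_bigr => j _; rewrite mxE.
by rewrite xM big1 // => k _; rewrite mxE scale0r.
Qed.

(** * The modules L(S, U) and U^S *)

Lemma hw_map_trunc (F : fieldType) (S : {fset int}) (U : lieModule (gl_sub F S))
    (V : lieModule (gl_full F)) (j : U -> V) x u :
  hw_map predT j -> lsub (gl_par F S) x ->
  j (lact (trunc S x) u) = lact x (j u).
Proof.
move=> hwj; have j0 := hw_map0 hwj; have [jlin jE jk] := hwj.
have tr0 : trunc S 0 = 0 := linear_at0 (trunc_linear (F := F) S).
rewrite /= mspan_add; elim=> [|c _ y [m [n [mn ->]]] _ IH].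
  by rewrite tr0 !lact0l j0.
rewrite trunc_linear (lact_linear_l c u (trunc_gl_sub S _) (trunc_gl_sub S _)).
rewrite jlin IH (@lact_linear_l F (gl_full F)) //; congr (_ *: _ + _).
rewrite trunc_E; case: mn => [nS|[mS nS]]; last by rewrite mS nS jE.
by rewrite (negbTE nS) andbF lact0l j0 jk.
Qed.

(** * The top of an induced module *)

Section InducedModule.
Variables (F : fieldType) (h p : lieSubalg F) (P : pred int) (S : {fset int}).
Hypotheses (hP : index_spanned h P) (SP : {subset S <= P}).
Hypotheses (ph : p `<=` h) (pS : p `<=` gl_par F S).
Hypothesis pE : forall m n, P m -> P n ->
  (n \notin S) || (m \in S) && (n \in S) -> lsub p (E F m n).
Variable U : lieModule (gl_sub F S).

Let M : lieModule h := induced h (inflation pS U).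

Definition ind_top (u : U) : M :=
  @pure F h p (inflation pS U) (1 : env h) u.

Lemma ind_top_lact m n u : P m -> P n ->
  (n \notin S) || (m \in S) && (n \in S) ->
  ind_top (lact (trunc S (E F m n)) u) = lact (E F m n) (ind_top u).
Proof.
move=> Pm Pn mn; rewrite -[RHS]/(ind_act (E F m n) (ind_top u)) ind_actE mulr1.
by rewrite -[Defs.iota _]mul1r (@pure_balanced F h p (inflation pS U)) //; apply: pE.
Qed.

Lemma ind_top_hw : hw_map P ind_top.
Proof.
have lin : linear ind_top by move=> c u v; apply: pure_linear_r.
split=> // [m n u mS nS|m n u Pm Pn nS].
  rewrite -ind_top_lact; [|exact: SP|exact: SP|by rewrite mS nS orbT].
  by rewrite trunc_E mS nS.
rewrite -ind_top_lact ?nS // trunc_E (negbTE nS) andbF lact0l.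
exact: (linear_at0 lin).
Qed.

(** By the universal property, the embedding of [U] into [cell_module] factors through [ind_top]. *)
Lemma ind_top_injective u : ind_top u = 0 -> u = 0.
Proof.
pose W := @restrict_module F (gl_full F) h (@subsetT _ _) (cell_module U).
move=> /(@pure1_eq0 F h p (inflation pS U) W (@cell_const F S U) u ph) eq0.
apply: (@cell_const_injective F S); apply: eq0.
  by have [] := cell_const_hw U.
move=> x v /pS px; exact: (hw_map_trunc v (cell_const_hw U) px).
Qed.

Lemma ind_top_gen (L : set M) : is_submodule L -> range ind_top `<=` L -> L = setT.
Proof.
move=> [Ls LE] topL; apply/seteqP; split=> // m _.
suff Lpure (a : env h) u : L (@pure F h p (inflation pS U) a u).
  elim/tens_ind: m => [|c a u m Lm]; first exact: (subspace0 Ls).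
  by apply: Ls.2.
have L0 : L (@pure F h p (inflation pS U) 0 u).
  have := @pure_linear_l F h p (inflation pS U) (-1) 0 0 u.
  rewrite !scaleN1r oppr0 addr0 addNr => ->; exact: (subspace0 Ls).
have Lword (s : seq (gl F)) :
    L (@pure F h p (inflation pS U) (qalg_pi (env_relator h) << FMonom s >>) u).
  elim: s => [|x s IH].
    have -> : (<< FMonom [::] >> : free_alg F (gl F)) = 1 by rewrite -fmoneE.
    by apply: topL; exists u.
  have -> : (<< FMonom (x :: s) >> : free_alg F (gl F)) =
      free_gen F x * << FMonom s >>.
    have -> : FMonom (x :: s) = fmmul (fmu x) (FMonom s) by rewrite fmmulE fmuE.
    by rewrite malgM_def fgmulUU mulr1.
  rewrite qalg_piMr -[qalg_pi _ (free_gen F x)]/(Defs.iota x : env h).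
  have [hx|hx] := pselect (lsub h x); last by rewrite (iota_outside hx) mul0r.
  rewrite -ind_actE; exact: (LE x _ hx IH).
rewrite -[a]qalg_reprK; elim/free_alg_ind: (qalg_repr a) => [|c [s] b Lb].
  by rewrite linear0.
by rewrite linearP pure_linear_l; apply: Ls.2 => //; apply: Lword.
Qed.

End InducedModule.

Section Irreducibles.
Variables (F : fieldType) (S1 : {fset int}) (U : lieModule (gl_sub F S1)) (a : F).
Hypothesis natI : injective (fun k : nat => k%:R : F).
Hypotheses (irrU : irreducible U) (aU : euler_scalar U a).

Lemma irreducible_ind_top (h p : lieSubalg F) (pS : p `<=` gl_par F S1) :
  p `<=` h -> exists u, ind_top h pS (U := U) u <> 0.
Proof.
by move=> ph; have [[u u0] _] := irrU; exists u => /(ind_top_injective ph).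
Qed.

Lemma up_mod_hw (S : {fset int}) (sS : (S1 `<=` S)%fset) :
  irreducible (up_mod sS U) /\ exists i : U -> up_mod sS U,
    hw_map (mem S) i /\ exists u, i u <> 0.
Proof.
have subP := @gl_sub_spanned F S.
have S1S : {subset S1 <= mem S} by apply/fsubsetP.
have ph : gl_par_in F sS `<=` gl_sub F S.
  rewrite /= mspan_add => x; apply: lspan_min; first exact: lspan_subspace.
  move=> _ [m [n [mn ->]]]; apply: mspan_E; case: mn => [[mS nS _]//|[mS nS]].
  by split; apply: S1S.
have pE m n : mem S m -> mem S n -> (n \notin S1) || (m \in S1) && (n \in S1) ->
    lsub (gl_par_in F sS) (E F m n).
  move=> mS nS mn; rewrite /= mspan_add; apply: mspan_E.
  by case/orP: mn => [nS1|/andP[]]; [left | right].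
have hwi := ind_top_hw (gl_sub F S) S1S (@gl_par_in_sub F S S1 sS) pE U.
have neq0 := @irreducible_ind_top (gl_sub F S) _ (@gl_par_in_sub F S S1 sS) ph.
have gen := @ind_top_gen F (gl_sub F S) _ S1 (@gl_par_in_sub F S S1 sS) U.
have [irr hwq qneq0] := @quotient_hw F _ (mem S) S1 subP S1S natI U a irrU aU _ _
  hwi neq0 gen (@ind_proper F S S1 sS U) (@ind_proper_sub F S S1 sS U)
  (fun K => @proj2 _ _) (fun K Ks KT => conj Ks KT).
split=> //.
by exists (qpi _ \o ind_top (gl_sub F S) (@gl_par_in_sub F S S1 sS) (U := U)).
Qed.

Let M := M_mod U.
Let top (u : U) : M := ind_top (gl_full F) (@subset_refl _ (gl_par F S1)) u.

(** It remains to see that [M_small] consists of the proper submodules, so that [quotient_hw]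
    applies: layer [k] lies in degree [- k], submodules contain layer components, and degree 0 is
    the top. *)
Lemma L_mod_hw :
  irreducible (L_mod U) /\ exists i : U -> L_mod U,
    hw_map predT i /\ exists u, i u <> 0.
Proof.
have fullP := @gl_full_spanned F; have S1T := @sub_predT S1.
have ph : gl_par F S1 `<=` gl_full F by [].
have pE m n : predT m -> predT n -> (n \notin S1) || (m \in S1) && (n \in S1) ->
    lsub (gl_par F S1) (E F m n).
  move=> _ _ mn; rewrite /= mspan_add; apply: mspan_E.
  by case/orP: mn => [nS1|/andP[]]; [left | right].
have hwi : @hw_map F (gl_full F) predT S1 U M top := ind_top_hw (gl_full F) S1T _ pE U.
have neq0 : exists u, top u <> 0 := @irreducible_ind_top (gl_full F) _ _ ph.
have gen : forall L : set M, is_submodule L -> range top `<=` L -> L = setT.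
  exact: ind_top_gen.
have topt := hw_top aU hwi.
have genT v : gen_submod predT S1 (range top) v.
  rewrite (gen _ (gen_submodule fullP S1T topt)) // => w tw.
  exact: (@gen_layer _ _ _ _ _ _ _ topt 0%N).
have deg_act k m n (v : M) : M_deg k v ->
    M_deg (deg S1 (m, n) + k) (lact (E F m n) v : M).
  elim=> [|c x y [w [u [wk ->]]] _ IH].
    by rewrite lact0 //; apply: lspan0.
  rewrite lactD // lactZ //; apply: lspanS IH.
  exists ((m, n) :: w), u; rewrite !big_cons wk; split=> //.
  exact: ind_actE.
have layer_deg k (v : M) : layer predT S1 (range top) k v -> M_deg (- k%:Z) v.
  elim: k v => [|k IH] v /=.
    move=> [u _ <-]; apply: lspan_gen; exists [::], u.
    by rewrite !big_nil oppr0.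
  elim=> [|c x y [m [n [w [_ mS nS Kw ->]]]] _ IHy]; first exact: lspan0.
  apply: (lspan_subspace _).2 => //.
  have -> : - k.+1%:Z = deg S1 (m, n) + - k%:Z.
    by rewrite /deg /= (negbTE mS) nS -opprD.
  exact/deg_act/IH.
(* A word of total degree 0 preserves the eigenvalue [a] of [I_S], so its value lies in the top by
   [gen_top]. *)
have deg0_top (v : M) : M_deg 0 v -> exists u, v = top u.
  move=> v0; suff : range top v by case=> u _ <-; exists u.
  apply: (gen_top fullP S1T topt natI) => //.
  have eL := euler_linear fullP S1T (V := M).
  elim: v0 => [|c x y [w [u [w0 ->]]] _ IH].
    by rewrite (linear_at0 eL) scaler0.
  rewrite eL IH scalerDr; congr (_ + _); rewrite scalerA mulrC -scalerA.
  (* The eigenvalue is rewritten as [a] plus the degree of the word, so that the induction can run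
     over words of arbitrary degree. *)
  congr (_ *: _); rewrite -[a]addr0 -[0]/((0 : int)%:~R) -w0.
  elim: w {w0} => [|[m n] w IHw].
    rewrite !big_nil addr0; have [_ _ _ topI] := topt; apply: topI; by exists u.
  rewrite !big_cons -ind_actE.
  set v' := pure _ u in IHw *.
  rewrite -[ind_act _ _]/(lact (E F m n) (v' : M)) (euler_E fullP S1T) // IHw.
  rewrite lactZ // -scalerDl; congr (_ *: _); rewrite intrD -addrA; congr (_ + _).
  rewrite addrC; congr (_ + _); rewrite /deg /=.
  by case: (m \in S1); case: (n \in S1); rewrite /= ?subrr ?subr0 ?sub0r.
have small_proper K : @M_small F S1 U K -> K <> setT.
  move=> [_ _ K0] KT; have [u u0] := neq0; apply: u0; apply: K0.
  by split; [rewrite KT | apply: (layer_deg 0%N); exists u].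
have proper_small K : is_submodule K -> K <> setT -> @M_small F S1 U K.
  move=> Ks KT; split=> // [v Kv|v [Kv /deg0_top [u vE]]].
    have [n [vs [Lvs vE]]] := genT v.
    have Kvs k : (k < n)%N -> K (vs k).
      apply: (layer_components fullP S1T topt natI Ks.1) Lvs _ k.
        by move=> w; apply: (euler_submodule fullP S1T Ks).
      by rewrite -vE.
    rewrite vE; apply: (subspace_sum (lspan_subspace _)) => k _; apply: lspan_gen.
    by split; [apply: Kvs | exists (- (k : nat)%:Z); apply: layer_deg].
  have u0 : u = 0.
    by apply: (proper_top fullP S1T irrU hwi gen Ks KT); rewrite -vE.
  by rewrite /= vE u0 (hw_map0 hwi).
have [irr hwq qneq0] := @quotient_hw F _ predT S1 fullP S1T natI U a irrU aU M top
  hwi neq0 gen (@M_small F S1 U) (@M_small_sub F S1 U) small_proper proper_small.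
by split=> //; exists (qpi _ \o top).
Qed.

End Irreducibles.

(** * Isomorphisms between modules with tops over the same [S] *)

Section Comparison.
Variables (F : fieldType) (S : {fset int}).
Hypothesis natI : injective (fun k : nat => k%:R : F).
Let fullP := @gl_full_spanned F.
Let ST := @sub_predT S.

Lemma hw_gen_irreducible (U : lieModule (gl_sub F S)) a (L : lieModule (gl_full F))
    (j : U -> L) :
  euler_scalar U a -> irreducible L -> hw_map predT j -> (exists u, j u <> 0) ->
  gen_submod predT S (range j) = setT.
Proof.
move=> aU irrL hwj [u u0]; have topj := hw_top aU hwj.
have [g0|//] := irrL.2 _ (gen_submodule fullP ST topj).
case: u0; have : gen_submod predT S (range j) (j u).
  by apply: (@gen_layer _ _ _ _ _ _ _ topj 0%N); exists u.
by rewrite g0.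
Qed.

Variables (X1 X2 : lieModule (gl_sub F S)) (a1 a2 : F).
Hypotheses (irrX1 : irreducible X1) (irrX2 : irreducible X2).
Hypotheses (a1X : euler_scalar X1 a1) (a2X : euler_scalar X2 a2).

(** Each top lies in the module generated by the other, so each of [a1], [a2] is the other minus a
    natural number. They are therefore equal, and both ranges are the same eigenspace of [I_S]. *)
Lemma hw_range_eq (L : lieModule (gl_full F)) (j1 : X1 -> L) (j2 : X2 -> L) :
  irreducible L -> hw_map predT j1 -> hw_map predT j2 ->
  (exists u, j1 u <> 0) -> (exists u, j2 u <> 0) -> range j1 = range j2.
Proof.
move=> irrL hw1 hw2 n1 n2.
have top1 := hw_top a1X hw1; have top2 := hw_top a2X hw2.
have g1 := hw_gen_irreducible a1X irrL hw1 n1.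
have g2 := hw_gen_irreducible a2X irrL hw2 n2.
have [_ _ _ I1] := top1; have [_ _ _ I2] := top2.
have [k1 a2E] : exists k : nat, a2 = a1 - k%:R.
  have [u u0] := n2; have : gen_submod predT S (range j1) (j2 u) by rewrite g1.
  move=> /(gen_eigen fullP ST top1 natI) /(_ (I2 _ _)) [|//|[k aE _]].
    by exists u.
  by exists k.
have [k2 a1E] : exists k : nat, a1 = a2 - k%:R.
  have [u u0] := n1; have : gen_submod predT S (range j2) (j1 u) by rewrite g2.
  move=> /(gen_eigen fullP ST top2 natI) /(_ (I1 _ _)) [|//|[k aE _]].
    by exists u.
  by exists k.
have a12 : a1 = a2.
  have : a2 - (k1 + k2)%:R = a2 - 0%:R.
    by rewrite natrD opprD addrA addrAC -a1E -a2E subr0.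
  move=> /addrI /oppr_inj /natI /eqP; rewrite addn_eq0 => /andP[/eqP k10 _].
  by rewrite a2E k10 subr0.
apply/seteqP; split=> v vr.
  apply: (gen_top fullP ST top2 natI); first by rewrite g2.
  by rewrite -a12; apply: I1.
apply: (gen_top fullP ST top1 natI); first by rewrite g1.
by rewrite a12; apply: I2.
Qed.

Variables L1 L2 : lieModule (gl_full F).
Variables (j1 : {linear X1 -> L1}) (j2 : {linear X2 -> L2}).
Hypotheses (irrL1 : irreducible L1) (irrL2 : irreducible L2).
Hypotheses (inj1 : injective j1) (inj2 : injective j2).
Hypotheses (hw1 : hw_map predT j1) (hw2 : hw_map predT j2).
Hypothesis j1E :
  forall x u, lsub (gl_sub F S) x -> j1 (lact x u) = lact x (j1 u).
Hypothesis j2E :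
  forall x u, lsub (gl_sub F S) x -> j2 (lact x u) = lact x (j2 u).

Fact injective_neq0 (X : lieModule (gl_sub F S)) (L : lieModule (gl_full F))
    (j : {linear X -> L}) : irreducible X -> injective j -> exists u, j u <> 0.
Proof.
by move=> [[u u0] _] jinj; exists u => ju0; apply/u0/jinj; rewrite ju0 linear0.
Qed.

(** An isomorphism from [L1] carries its top to a second top of [L2], which has the same range as
    [j2]. Conversely, an isomorphism of tops makes [X1] the top of both modules, and [hw_extend]
    applies. *)
Lemma lie_iso_top : lie_iso L1 L2 <-> lie_iso X1 X2.
Proof.
have n1 := injective_neq0 irrX1 inj1; have n2 := injective_neq0 irrX2 inj2.
split=> [[th [thbij thE]]|[psi [psibij psiE]]].
  pose j : {linear X1 -> L2} := th \o j1.
  have jinj : injective j by apply: inj_comp inj1; apply: bij_inj.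
  have jE x u : lsub (gl_sub F S) x -> j (lact x u) = lact x (j u).
    by move=> hx; rewrite /j /= j1E // thE.
  have hwj : hw_map predT j.
    have [_ hE hk] := hw1; split=> [|m n u mS nS|m n u _ _ nS].
    - exact: linearP.
    - by rewrite /j /= hE // thE.
    - by rewrite /j /= -thE // hk // linear0.
  apply: (lie_iso_same_range jinj inj2) => //.
  exact: hw_range_eq hwj hw2 (injective_neq0 irrX1 jinj) n2.
pose j : {linear X1 -> L2} := j2 \o psi.
have jinj : injective j by apply: inj_comp inj2 _; apply: bij_inj.
have hwj : hw_map predT j.
  have [_ hE hk] := hw2; split=> [|m n u mS nS|m n u _ _ nS].
  - exact: linearP.
  - rewrite /j /= psiE ?hE //; exact: (index_E (@gl_sub_spanned F S)).
  - by rewrite /j /= hk.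
have n := injective_neq0 irrX1 jinj.
have genT := hw_gen_irreducible a1X irrL2 hwj n.
have [K Ks _|phi [phi_inj phiE _ phiT]] :=
  hw_extend fullP ST natI irrX1 a1X irrL1 hw1 hwj n1 n.
  by rewrite genT; have [->|->] := irrL2.2 _ Ks; [left | right].
exists phi; split; first by apply: bijective_of_range => //; rewrite phiT.
by move=> x v _; apply: phiE.
Qed.

End Comparison.

Theorem corollary3p8 (R : realType) (S1 S2 : {fset int})
  (U1 : lieModule (gl_sub R[i] S1)) (U2 : lieModule (gl_sub R[i] S2)) :
  S1 != fset0 -> S2 != fset0 -> irreducible U1 -> irreducible U2 ->
  let S := (S1 `|` S2)%fset in
  lie_iso (L_mod U1) (L_mod U2) <->
  lie_iso (up_mod (fsubsetUl S1 S2 : (S1 `<=` S)%fset) U1)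
          (up_mod (fsubsetUr S1 S2 : (S2 `<=` S)%fset) U2).
Proof.
move=> _ _ irr1 irr2 S.
have natI : injective (fun k : nat => k%:R : R[i]).
  by move=> i j /eqP; rewrite Num.Theory.eqr_nat => /eqP.
have [a1 a1U] := irreducible_euler_scalar (@complex_uncountable R) irr1.
have [a2 a2U] := irreducible_euler_scalar (@complex_uncountable R) irr2.
have [irrL1 [j1 [hw1 n1]]] := L_mod_hw natI irr1 a1U.
have [irrL2 [j2 [hw2 n2]]] := L_mod_hw natI irr2 a2U.
have [irrX1 [i1 [hwi1 ni1]]] :=
  up_mod_hw natI irr1 a1U (fsubsetUl S1 S2 : (S1 `<=` S)%fset).
have [irrX2 [i2 [hwi2 ni2]]] :=
  up_mod_hw natI irr2 a2U (fsubsetUr S1 S2 : (S2 `<=` S)%fset).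
(* From here on L(S1, U1) and L(S2, U2) are seen as modules over the common [S], with tops U1^S and
   U2^S. *)
have [f1 [inj1 hwf1 aX1 f1E]] := hw_enlarge (fsubsetUl S1 S2 : (S1 `<=` S)%fset)
  natI irr1 a1U irrL1 irrX1 hw1 n1 hwi1 ni1.
have [f2 [inj2 hwf2 aX2 f2E]] := hw_enlarge (fsubsetUr S1 S2 : (S2 `<=` S)%fset)
  natI irr2 a2U irrL2 irrX2 hw2 n2 hwi2 ni2.
exact: lie_iso_top inj1 inj2 hwf1 hwf2 f1E f2E.
Qed.
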